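(* Let $k$ be a positive integer, let $V\subset\mathbb{P}(1,1,1,1,k)$ be a smooth weighted hypersurface, and let $\mathcal{D}$ be a regular (codimension one) distribution on $V$. Then $\deg(V)=k$ and $\deg(\mathcal{D})=2$.
   Context: $\mathbb{P}(1,1,1,1,k)=(\mathbb{C}^5-\{0\})/\mathbb{C}^*$ with action $t\cdot(z_0,z_1,z_2,z_3,z_4)=(tz_0,tz_1,tz_2,tz_3,t^kz_4)$. A weighted hypersurface $V$ of degree $\deg(V)=a$ is the scheme-theoretic zero locus of a weighted homogeneous polynomial $f$ of degree $a$ ($\deg z_0=\dots=\deg z_3=1$, $\deg z_4=k$). Smooth means that $V$ is a complex manifold and that $\{f=0\}\cap(\mathbb{C}^5-\{0\})$ is smooth of codimension one with this scheme structure. Distributions. A codimension one holomorphic distribution $\mathcal{D}$ of degree $d=\deg(\mathcal{D})$ on $V$ is given by a nonzero section of $\Omega^1_V(d)=\Omega^1_V\otimes\mathcal{O}_{\mathbb{P}(1,1,1,1,k)}(d)|_V$. Standing assumption: $d\geq1$ and the section lies in the image of the restriction map $H^0(\mathbb{P}(1,1,1,1,k),\Omega^1_{\mathbb{P}(1,1,1,1,k)}\otimes\mathcal{O}(d))\to H^0(V,\Omega^1_V(d))$. $\mathrm{Sing}(\mathcal{D})$ is the zero set of the section on $V$, and $\mathcal{D}$ is regular if $\mathrm{Sing}(\mathcal{D})=\varnothing$. *)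

(* Defs.v *)
(* Mathematical Components, with multinomials for polynomials and
   mathcomp-real-closed for the complex numbers R[i] over R : realType. *)
From HB Require Import structures.
From mathcomp Require Import all_boot all_order all_algebra.
From mathcomp Require Import complex mpoly reals.
Set Implicit Arguments.
Unset Strict Implicit.
Unset Printing Implicit Defensive.
Import GRing.Theory.
Local Open Scope ring_scope.

(* Weights of z_0, ..., z_4 on C^5: (1,1,1,1,k). *)
Definition weight (k : nat) (i : 'I_5) : nat := if i == ord_max then k else 1%N.

Definition wdeg (k : nat) (m : 'X_{1..5}) : nat :=
  (\sum_(i < 5) weight k i * m i)%N.

Lemma wdeg0 k : wdeg k 0%MM = 0%N.
Proof. by rewrite /wdeg big1 // => i _; rewrite mnm0E muln0. Qed.

Lemma wdegD k : {morph wdeg k : m1 m2 / (m1 + m2)%MM >-> (m1 + m2)%N}.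
Proof.
move=> m1 m2; rewrite /wdeg -big_split /=.
by apply: eq_bigr => i _; rewrite mnmDE mulnDr.
Qed.

HB.instance Definition _ k := isMeasure.Build 5 (wdeg k) (@wdeg0 k) (@wdegD k).

Notation cpoly R := {mpoly (complex R)[5]}.

Definition whomog (R : realType) (k d : nat) (g : cpoly R) : bool :=
  g \is @ishomog1 5 (complex R) d (wdeg k).

(* Points of P(1,1,1,1,k) are represented by their lifts to C^5 - {0}; every
   notion below depends only on the C^*-orbit of the lift. *)
Notation cpoint R := ('I_5 -> complex R).

Record hypersurface (R : realType) (k : nat) := Hypersurface {
  hdeg : nat;
  heqn : cpoly R;
  heqn_homog : whomog k hdeg heqn
}.

Section Hypersurface.
Variables (R : realType) (k : nat) (V : hypersurface R k).
Local Notation f := (heqn V).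

Definition on_hypersurface (p : cpoint R) : Prop :=
  (exists i, p i != 0) /\ f.@[p] = 0.

(* {f = 0} in C^5 - {0} is smooth of codimension one, as a scheme. *)
Definition cone_smooth : Prop :=
  forall p, on_hypersurface p -> exists i, (f^`M(i)).@[p] != 0.

(* The local ring O_{P,p} of P = P(1,1,1,1,k) = Proj C[z_0,...,z_4]: the
   fractions of weighted degree 0 whose denominator does not vanish at p. *)
Definition in_local_ring (p : cpoint R) (u : {fraction cpoly R}) : Prop :=
  exists e (g h : cpoly R),
    [/\ whomog k e g, whomog k e h, h.@[p] != 0 & u = tofrac g / tofrac h].

Definition in_maximal_ideal (p : cpoint R) (u : {fraction cpoly R}) : Prop :=
  exists e (g h : cpoly R),
    [/\ whomog k e g, whomog k e h, h.@[p] != 0, g.@[p] = 0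
      & u = tofrac g / tofrac h].

(* The ideal of V in O_{P,p}, so that O_{V,p} = O_{P,p} / I_{V,p}. *)
Definition in_ideal_of (p : cpoint R) (u : {fraction cpoly R}) : Prop :=
  exists e (g h : cpoly R),
    [/\ whomog k e (f * g), whomog k e h, h.@[p] != 0
      & u = tofrac (f * g) / tofrac h].

(* O_{V,p} is a regular local ring of dimension 3 = dim V: its maximal ideal
   is generated by three elements x_0, x_1, x_2 (given by lifts to O_{P,p}). *)
Definition regular_point (p : cpoint R) : Prop :=
  exists2 x : 'I_3 -> {fraction cpoly R},
    forall j, in_maximal_ideal p (x j) &
    forall u, in_maximal_ideal p u ->
      exists2 c : 'I_3 -> {fraction cpoly R},
        forall j, in_local_ring p (c j) &
        in_ideal_of p (u - \sum_(j < 3) c j * x j).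

(* V is a complex manifold, i.e. the scheme V = Proj C[z]/(f) is regular at
   every closed point.  This is not implied by cone_smooth: for k > 1 it
   excludes the quotient singularity [0:0:0:0:1] of P(1,1,1,1,k). *)
Definition is_manifold : Prop :=
  forall p, on_hypersurface p -> regular_point p.

Definition smooth_hypersurface : Prop := is_manifold /\ cone_smooth.

(* The value at p, on v in T_p C^5, of the 1-form sum_i A_i dz_i. *)
Definition form_at (A : 'I_5 -> cpoly R) (p v : cpoint R) : complex R :=
  \sum_(i < 5) (A i).@[p] * v i.

Definition cone_tangent (p v : cpoint R) : Prop :=
  \sum_(i < 5) (f^`M(i)).@[p] * v i = 0.

(* The restriction to V of the twisted 1-form A vanishes at [p]: A_p vanishes
   on the tangent space of the cone over V.  As A_p kills the Euler vector R_p,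
   it is a linear form on T_p(cone) / C R_p = T_[p] V. *)
Definition form_vanishes_at (A : 'I_5 -> cpoly R) (p : cpoint R) : Prop :=
  forall v, cone_tangent p v -> form_at A p v = 0.

(* Global sections of Omega^1_P(d) are, by the Euler sequence
   0 -> Omega^1_P(d) -> (+)_i O(d - w_i) -> O(d) -> 0,
   the forms sum_i A_i dz_i of weighted degree d (where dz_i has degree w_i)
   annihilated by the Euler field sum_i w_i z_i d/dz_i.  Asking that A_i z_i
   have degree d means deg A_i = d - w_i, and A_i = 0 when d < w_i. *)
Definition twisted_form (d : nat) (A : 'I_5 -> cpoly R) : Prop :=
  (forall i, whomog k d (A i * 'X_i)) /\
  \sum_(i < 5) (A i * 'X_i) *+ weight k i = 0.

(* dform is a section over P restricting to the section that defines the
   distribution on V. *)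
Record distribution := Distribution {
  ddeg : nat;
  dform : 'I_5 -> cpoly R;
  ddeg_gt0 : (1 <= ddeg)%N;
  dform_twisted : twisted_form ddeg dform;
  dform_neq0 : exists2 p, on_hypersurface p & ~ form_vanishes_at dform p
}.

Definition Sing (D : distribution) (p : cpoint R) : Prop :=
  on_hypersurface p /\ form_vanishes_at (dform D) p.

Definition regular_distribution (D : distribution) : Prop :=
  forall p, ~ Sing D p.

End Hypersurface.

(* Main.v *)
Require Import Defs.
From mathcomp Require Import all_boot all_order all_algebra.
From mathcomp Require Import complex mpoly reals.
From HB Require Import structures.
From mathcomp Require Import ring.
From Stdlib Require Import Classical.
Set Implicit Arguments.
Unset Strict Implicit.
Unset Printing Implicit Defensive.
Import Order.TTheory GRing.Theory Num.Theory.
Local Open Scope ring_scope.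

(** Let a be the degree of V, f its equation, d the degree of the distribution
    and A = sum_i A_i dz_i its form.  A point of V is a zero of the distribution
    exactly when A and df are proportional there, so regularity says that f and
    the minors A_i f_j - A_j f_i have no common zero in C^5 but the origin.
    The expected number of zeros on V is the degree of c_3(Omega_V(d)); for d >= 2
    and a a positive multiple of k, it is positive unless d = 2 and a = k.
    Instead of computing it, one exhibits for each other pair of degrees one pair
    (f', A') with one nondegenerate zero, and shows that this zero cannot
    disappear under deformation.

    Join (f', A') to (f, A) by the segment (f_t, A_t), 0 <= t <= 1.  Newton's
    iteration prolongs the zero of (f', A') to a point p(t), with p_0 = 1, which
    is a zero of (f_t, A_t) modulo an arbitrarily high power of t
    ([special3_path], [special2_path]).  On the other hand, if (f, A) has no
    zero, the Nullstellensatz puts all monomials of some weighted degree N in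
    the ideal of f and the minors.  Evaluated at p(t), these memberships become
    a linear system for the values of the monomials, whose matrix is the
    identity at t = 1.  Its determinant is therefore a nonzero polynomial in t
    and kills the value 1 of z_0^N modulo every power of t, which is absurd
    ([no_formal_zero]).

    Special pairs exist when d >= 3 and a >= k, and when d = 2 and a >= 2 k.
    There is no nonzero form of degree d = 1, so it remains to see that a is a
    positive multiple of k.  This holds as soon as V avoids the vertex
    [0:0:0:0:1], because f then contains a power of z_4.  For k > 1 a V through
    the vertex with a smooth cone has an equation z_4^j l(z_0, ..., z_3) + ...
    with l linear and nonzero.  The cotangent space of V at the vertex is then
    the space of forms of degree k on the plane l = 0, which has dimension at
    least 6, so the vertex is a singular point of V ([vertex_not_regular]). *)

(** * Ideals, and polynomials monic in one variable *)

Record is_ideal (B : comNzRingType) (J : B -> Prop) : Prop := IsIdeal {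
  ideal0 : J 0;
  idealD : forall a b, J a -> J b -> J (a + b);
  idealMl : forall c a, J a -> J (c * a)
}.

Section Ideals.
Variables (B : comNzRingType) (J : B -> Prop).
Hypothesis idJ : is_ideal J.

Lemma idealB a b : J a -> J b -> J (a - b).
Proof.
by move=> Ja Jb; rewrite -mulN1r; apply/(idealD idJ)/(idealMl idJ).
Qed.

Lemma ideal_sum (I : Type) (r : seq I) (P : pred I) (F : I -> B) :
  (forall i, P i -> J (F i)) -> J (\sum_(i <- r | P i) F i).
Proof. by move=> JF; elim/big_ind: _ => //; [apply: ideal0|apply: idealD]. Qed.

(** Cramer's rule: multiply the system by the adjugate matrix. *)
Lemma ideal_det n (M : 'M[B]_n) (v : 'I_n -> B) :
  (forall i, J (\sum_j M i j * v j)) -> forall i, J (\det M * v i).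
Proof.
move=> JM i; have -> : \det M * v i = \sum_l \adj M i l * \sum_j M l j * v j.
  under eq_bigr do rewrite mulr_sumr; rewrite exchange_big /=.
  transitivity (\sum_j (\adj M *m M) i j * v j); last first.
    by apply: eq_bigr => j _; rewrite mxE mulr_suml; apply: eq_bigr => l _; rewrite mulrA.
  rewrite mul_adj_mx (bigD1 i) //= mxE eqxx big1 ?addr0 // => j /negPf ij.
  by rewrite mxE eq_sym ij mul0r.
by apply: ideal_sum => l _; apply: (idealMl idJ).
Qed.

End Ideals.

Lemma ideal_preim (B C : comNzRingType) (h : {rmorphism C -> B}) (J : B -> Prop) :
  is_ideal J -> is_ideal (fun c => J (h c)).
Proof.
move=> [J0 JD JM]; split; rewrite ?rmorph0 // => a b; rewrite ?rmorphD ?rmorphM; auto.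
Qed.

Lemma ideal_image (B C : comNzRingType) (h : {rmorphism C -> B}) (J : C -> Prop) :
  (forall b, exists c, h c = b) -> is_ideal J ->
  is_ideal (fun b => exists2 c, J c & h c = b).
Proof.
move=> hS [J0 JD JM]; split; first by exists 0; rewrite ?rmorph0.
- by move=> _ _ [a Ja <-] [b Jb <-]; exists (a + b); rewrite ?rmorphD; auto.
move=> b _ [a Ja <-]; have [c <-] := hS b.
by exists (c * a); rewrite ?rmorphM; auto.
Qed.

(** Euclidean division lowers the size of [g] until it divides all of [J]; it is
    then not constant, and any of its roots will do. *)
Lemma poly_ideal_root (K : closedFieldType) (J : {poly K} -> Prop) g :
  is_ideal J -> ~ J 1 -> J g -> g != 0 -> exists x, forall h, J h -> root h x.
Proof.
move=> idJ J1; have [n] := ubnP (size g); elim: n g => // n IHn g szg Jg g0.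
have Jmod h : J h -> J (h %% g).
  move=> Jh; have -> : h %% g = h - h %/ g * g.
    by rewrite {2}(divp_eq h g) addrAC subrr add0r.
  by apply: (idealB idJ) => //; apply: (idealMl idJ).
have [[h Jh hg]|gdiv] := classic (exists2 h, J h & h %% g != 0).
  by apply: IHn (Jmod h Jh) hg; rewrite -ltnS; apply: leq_trans szg; rewrite ltnS ltn_modp.
have /closed_rootP[x gx] : size g != 1%N.
  apply: contra_not_neq J1 => /eqP/size_poly1P[c c0 eg].
  by have := idealMl idJ (c^-1)%:P Jg; rewrite eg -polyCM mulVf.
exists x => h Jh; have [hg|hg] := eqVneq (h %% g) 0; last by case: gdiv; exists h.
by rewrite (divp_eq h g) hg addr0 rootM gx orbT.
Qed.

Lemma digits_inj n e (a b : nat -> nat) :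
  (forall i, a i < e)%N -> (forall i, b i < e)%N ->
  (\sum_(i < n) a i * e ^ i = \sum_(i < n) b i * e ^ i)%N ->
  forall i, (i < n)%N -> a i = b i.
Proof.
elim: n a b => // n IHn a b ae be.
have shift (c : nat -> nat) :
    (\sum_(i < n.+1) c i * e ^ i = (\sum_(i < n) c i.+1 * e ^ i) * e + c 0%N)%N.
  rewrite big_ord_recl /= muln1 addnC; congr (_ + _)%N.
  by rewrite big_distrl; apply: eq_bigr => i _; rewrite /bump add1n expnSr mulnA.
rewrite !shift => E.
have e0 : (0 < e)%N by exact: leq_ltn_trans (leq0n _) (ae 0%N).
have E0 : a 0%N = b 0%N.
  by have := congr1 (modn^~ e) E; rewrite !modnMDl !modn_small.
case=> // i; rewrite ltnS; apply: (IHn (a \o S) (b \o S)) => [j|j|] /=; [exact: ae|exact: be|].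
by move/eqP: E; rewrite E0 eqn_add2r eqn_pmul2r // => /eqP.
Qed.

Lemma mpoly_rmorph_ext (R : nzRingType) (S : comNzRingType) n
    (u v : {rmorphism {mpoly R[n]} -> S}) :
  (forall c, u c%:MP = v c%:MP) -> (forall i, u 'X_i = v 'X_i) -> u =1 v.
Proof.
move=> uvC uvX p; rewrite (mpolyE p) !rmorph_sum; apply: eq_bigr => m _.
rewrite -mul_mpolyC !rmorphM uvC mpolyXE_id !rmorph_prod; congr (_ * _).
by apply: eq_bigr => i _; rewrite !rmorphXn uvX.
Qed.

Section Nagata.
Variables (K : fieldType) (n e : nat).
Local Notation A := {mpoly K[n]}.

(** The value 0 at [ord0] makes the first variable go to ['X^(e ^ 0)] = ['X], so
    that one formula describes the change of variables. *)
Definition nagata_base (i : 'I_n.+1) : A :=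
  if unlift ord0 i is Some j then 'X_j else 0.

(** Nagata's substitution [X_i + X^(e ^ i)]: it replaces a linear change of
    coordinates in general position, and needs no choice of coefficients. *)
Definition nagata : {mpoly K[n.+1]} -> {poly A} :=
  mmap (polyC \o @mpolyC n K) (fun i => (nagata_base i)%:P + 'X^(e ^ i)).
HB.instance Definition _ := GRing.RMorphism.on nagata.

Definition nagata_inv0 : A -> {mpoly K[n.+1]} :=
  mmap (@mpolyC n.+1 K) (fun j => 'X_(lift ord0 j) - 'X_ord0 ^+ (e ^ lift ord0 j)).
HB.instance Definition _ := GRing.RMorphism.on nagata_inv0.

Definition nagata_inv : {poly A} -> {mpoly K[n.+1]} :=
  horner_eval 'X_ord0 \o map_poly nagata_inv0.
HB.instance Definition _ := GRing.RMorphism.on nagata_inv.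

Lemma nagata_invE q : nagata_inv q = (map_poly nagata_inv0 q).['X_ord0].
Proof. by []. Qed.

Lemma nagataC c : nagata c%:MP = c%:MP%:P.
Proof. exact: mmapC. Qed.

Lemma nagataX m : nagata 'X_[m] = \prod_i ((nagata_base i)%:P + 'X^(e ^ i)) ^+ m i.
Proof. exact: mmapX. Qed.

Lemma nagata_inv0X j :
  nagata_inv0 'X_j = 'X_(lift ord0 j) - 'X_ord0 ^+ (e ^ lift ord0 j).
Proof. by rewrite /nagata_inv0 mmapX mmap1U. Qed.

Lemma nagataK : cancel nagata nagata_inv.
Proof.
apply: (mpoly_rmorph_ext (u := nagata_inv \o nagata) (v := idfun)) => [c|i] /=.
  rewrite nagataC nagata_invE map_polyC hornerC; exact: mmapC.
rewrite /nagata mmapX mmap1U nagata_invE rmorphD /= map_polyC map_polyXn hornerD hornerC hornerXn.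
rewrite /nagata_base; case: unliftP => [j ->|->]; last first.
  by rewrite [X in X + _](mmap0 _ _) add0r expn0.
by apply: etrans (congr1 (+%R^~ _) (nagata_inv0X j)) (subrK _ _).
Qed.

Definition nagata_deg (m : 'X_{1..n.+1}) := (\sum_(i < n.+1) m i * e ^ i)%N.

Lemma nagataX_monic m : (0 < e)%N ->
  nagata 'X_[m] \is monic /\ size (nagata 'X_[m]) = (nagata_deg m).+1.
Proof.
move=> e0; rewrite nagataX /nagata_deg.
elim/big_rec2: _ => [|i p d _ [pm ps]]; first by rewrite monic1 size_poly1.
have sz : (size (nagata_base i)%:P < size ('X^(e ^ i) : {poly A}))%N.
  by rewrite size_polyXn ltnS; apply: leq_trans (size_polyC_leq1 _) _; rewrite expn_gt0 e0.
have bm : ((nagata_base i)%:P + 'X^(e ^ i)) \is monic.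
  by rewrite monicE addrC lead_coefDl // lead_coefXn.
have bs : size ((nagata_base i)%:P + 'X^(e ^ i)) = (e ^ i).+1.
  by rewrite addrC size_polyDl // size_polyXn.
split; first by rewrite monicMl // monic_exp.
rewrite size_monicM ?monic_exp ?monic_neq0 // ps addnS /= -addSn.
have := size_exp ((nagata_base i)%:P + 'X^(e ^ i)) (m i); rewrite bs /=.
case: size (size_poly_eq0 (((nagata_base i)%:P + 'X^(e ^ i)) ^+ m i)) => [|s _ /= ->].
  by move=> /esym; rewrite eqxx (negPf (monic_neq0 (monic_exp _ bm))).
by rewrite mulnC addSn.
Qed.

(** Monomials go to monic polynomials whose degrees are their exponents read as
    digits in base [e].  These degrees are pairwise distinct, so the leading
    coefficient comes from a single monomial. *)
Lemma nagata_lead p : p != 0 -> (forall m i, m \in msupp p -> m i < e)%N ->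
  exists2 c, c != 0 & lead_coef (nagata p) = c%:MP.
Proof.
move=> p0 pe; have m1P := mlead_supp p0.
have e0 : (0 < e)%N by exact: leq_ltn_trans (leq0n _) (pe _ ord0 m1P).
have [m0 m0P m0max] : exists2 m0, m0 \in msupp p &
    forall m, m \in msupp p -> (nagata_deg m <= nagata_deg m0)%N.
  have exd : exists d, has (fun m => nagata_deg m == d) (msupp p).
    by exists (nagata_deg (mlead p)); apply/hasP; exists (mlead p).
  have bd d : has (fun m => nagata_deg m == d) (msupp p) ->
      (d <= \sum_(m <- msupp p) nagata_deg m)%N.
    by case/hasP => m mp /eqP <-; rewrite (big_rem m mp) leq_addr.
  case: (ex_maxnP exd bd) => d /hasP[m0 m0P /eqP <-] dmax; exists m0 => // m mP.
  by apply: dmax; apply/hasP; exists m.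
have inj m : m \in msupp p -> nagata_deg m = nagata_deg m0 -> m = m0.
  move=> mP E; apply/mnmP => i.
  have get (m' : 'X_{1..n.+1}) (j : 'I_n.+1) : m' (inord j) = m' j by rewrite inord_val.
  have := @digits_inj n.+1 e (fun j => m (inord j)) (fun j => m0 (inord j)).
  move=> /(_ (fun j => pe _ _ mP) (fun j => pe _ _ m0P)).
  rewrite (eq_bigr (fun j : 'I_n.+1 => m j * e ^ j)%N); last by move=> j _; rewrite get.
  rewrite [in X in _ = X -> _](eq_bigr (fun j : 'I_n.+1 => m0 j * e ^ j)%N); last first.
    by move=> j _; rewrite get.
  by move=> /(_ E i (ltn_ord i)); rewrite !get.
exists p@_m0; first by rewrite -mcoeff_msupp.
rewrite {1}(mpolyE p) rmorph_sum (bigD1_seq m0) ?msupp_uniq //=.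
have term m : nagata (p@_m *: 'X_[m]) = ((p@_m)%:MP)%:P * nagata 'X_[m].
  by rewrite -mul_mpolyC rmorphM /= nagataC.
have [mon sz] := nagataX_monic m0 e0.
have sz0 : size (nagata (p@_m0 *: 'X_[m0])) = (nagata_deg m0).+1.
  by rewrite term mul_polyC size_scale ?sz // mpolyC_eq0 -mcoeff_msupp.
rewrite lead_coefDl; first by rewrite term mul_polyC lead_coefZ (monicP mon) mulr1.
rewrite sz0 ltnS (leq_trans (size_sum _ _ _)) //; apply/bigmax_leqP_seq => m mP mm0.
rewrite term mul_polyC (leq_trans (size_scale_leq _ _)) //.
have [_ ->] := nagataX_monic m e0.
rewrite ltn_neqAle m0max // andbT; apply: contra_neq mm0; exact: inj.
Qed.

End Nagata.

(** * The weak Nullstellensatz *)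

(** Otherwise some [g] in [J] is sent to 1.  Its norm from [A[X]/(F)] to [A]
    belongs to [J], hence is killed by [ev], while it is sent to the norm of 1. *)
Lemma zero_extension (K : closedFieldType) (A : comNzRingType)
    (ev : {rmorphism A -> K}) (J : {poly A} -> Prop) F :
  (forall c, exists a, ev a = c) -> is_ideal J ->
  (forall a, J a%:P -> ev a = 0) ->
  J F -> F \is monic -> (1 < size F)%N ->
  exists b, forall g, J g -> root (map_poly ev g) b.
Proof.
move=> evS idJ JA JF monF szF.
have mapS q : exists p, map_poly ev p = q.
  elim/poly_ind: q => [|q c [p <-]]; first by exists 0; rewrite rmorph0.
  have [a <-] := evS c.
  by exists (p * 'X + a%:P); rewrite rmorphD rmorphM /= map_polyX map_polyC.
have monF' : map_poly ev F \is monic by exact: monic_map.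
have szF' : size (map_poly ev F) = size F.
  by rewrite size_map_poly_id0 // (monicP monF) rmorph1 oner_neq0.
have [|||b rb] := @poly_ideal_root K _ (map_poly ev F) (ideal_image mapS idJ); last first.
- by exists b => g Jg; apply: rb; exists g.
- exact: monic_neq0.
- by exists F.
case=> g Jg g1.
pose r i := Pdiv.Ring.rmodp ('X^i * g) F.
pose q i := Pdiv.Ring.rdivp ('X^i * g) F.
have rE i : 'X^i * g = q i * F + r i by exact: Pdiv.RingMonic.rdivp_eq.
have szr i : (size (r i) < size F)%N by rewrite Pdiv.Ring.ltn_rmodpN0 ?monic_neq0.
have Jr i : J (r i).
  have -> : r i = 'X^i * g - q i * F by rewrite rE addrAC subrr add0r.
  by apply: (idealB idJ); apply: (idealMl idJ).
have mapr i : (i < (size F).-1)%N -> map_poly ev (r i) = 'X^i.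
  move=> iF; have := congr1 (map_poly ev) (rE i).
  rewrite !rmorphD !rmorphM /= map_polyXn g1 mulr1 => E.
  have szi : (size ('X^i : {poly K}) < size (map_poly ev F))%N.
    by rewrite size_polyXn szF' -ltn_predRL.
  have := Pdiv.RingMonic.rmodp_addl_mul_small monF' (map_poly ev (q i)).
  move/(_ (map_poly ev (r i))); rewrite -E Pdiv.Ring.rmodp_small // => -> //.
  by rewrite szF' (leq_ltn_trans (size_poly _ _)) // szr.
(* [M] is the matrix of the multiplication by [g] in the basis of powers of
   ['X]; the first of these powers is 1, so [J] contains the determinant itself. *)
pose M := \matrix_(i < (size F).-1, j < (size F).-1) (r i)`_j.
have D0 : (0 < (size F).-1)%N by rewrite ltn_predRL.
have /(ideal_det idJ (v := fun j => 'X^j))/(_ (Ordinal D0)) :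
    forall i, J (\sum_j (map_mx polyC M) i j * 'X^j).
  move=> i; have -> : \sum_j (map_mx polyC M) i j * 'X^j = r i; last exact: Jr.
  transitivity (\poly_(j < (size F).-1) (r i)`_j).
    by rewrite poly_def; apply: eq_bigr => j _; rewrite !mxE mul_polyC.
  apply/polyP => j; rewrite coef_poly; case: ltnP => // Dj.
  by rewrite nth_default // (leq_trans _ Dj) // -ltnS prednK // ltnW.
rewrite expr0 mulr1 det_map_mx => /JA.
rewrite -det_map_mx (_ : map_mx ev M = 1%:M) ?det1; first by move/eqP; rewrite oner_eq0.
by apply/matrixP => i j; rewrite !mxE -coef_map mapr // coefXn eq_sym.
Qed.

(** Arrondo's proof, by induction on [n]: once [J] contains a polynomial monic in
    the first variable, a zero of the elements of [J] free of this variable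
    extends to a zero of [J]. *)
Theorem weak_nullstellensatz (K : closedFieldType) n (J : {mpoly K[n]} -> Prop) :
  is_ideal J -> (forall x, exists2 g, J g & g.@[x] != 0) -> J 1.
Proof.
elim: n J => [|n IHn] J idJ noz.
  have [g Jg] := noz (fun=> 0); rewrite (nvar0_mpolyC g) mevalC => c0.
  rewrite (_ : 1 = ((g@_0)^-1)%:MP * g); first exact: (idealMl idJ).
  by rewrite {2}(nvar0_mpolyC g) -mpolyCM mulVf.
apply: NNPP => J1.
have [f Jf f0] : exists2 f, J f & f != 0.
  have [g Jg gx] := noz (fun=> 0); exists g => //.
  by apply: contraNneq gx => ->; rewrite meval0.
pose e := msize f.
have [m i mf|c c0 lc] := @nagata_lead K n e f f0.
  rewrite (leq_ltn_trans _ (msize_mdeg_lt mf)) // mdegE.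
  by rewrite (bigD1 i) //= leq_addr.
pose J' (q : {poly {mpoly K[n]}}) := J (nagata_inv e q).
have idJ' : is_ideal J' by exact: ideal_preim.
(* The factor ['X] serves to make [F] nonconstant. *)
pose F := 'X * ((c^-1)%:MP *: nagata e f).
have J'F : J' F.
  apply: (idealMl idJ'); rewrite -mul_polyC; apply: (idealMl idJ').
  by rewrite /J' nagataK.
have c1 : (c^-1)%:MP * c%:MP = 1 :> {mpoly K[n]} by rewrite -mpolyCM mulVf.
have cf0 : (c^-1)%:MP *: nagata e f != 0.
  by rewrite -lead_coef_eq0 lead_coefZ lc c1 oner_eq0.
have monF : F \is monic.
  by rewrite monicE lead_coefM lead_coefX mul1r lead_coefZ lc c1.
have szF : (1 < size F)%N by rewrite /F mulrC size_mulX // ltnS lt0n size_poly_eq0.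
have [a Ja] : exists a : 'I_n -> K, forall h, J' h%:P -> h.@[a] = 0.
  apply: NNPP => H; apply: J1.
  have : J' 1%:P; last by rewrite /J' rmorph1.
  apply: (IHn (fun h => J' h%:P)) => [|x].
    exact: (@ideal_preim _ _ (@polyC {mpoly K[n]})).
  apply: NNPP => Hx; apply: H; exists x => h Jh; apply/eqP; apply: contraT => hx.
  by case: Hx; exists h.
have [b Jb] : exists b, forall g, J' g -> root (map_poly (meval a) g) b.
  by apply: (zero_extension (F := F)) => // x; exists x%:MP; exact: mevalC.
have [g Jg] := noz (fun i => (nagata_base K i).@[a] + b ^+ (e ^ i)).
have Jng : J' (nagata e g) by rewrite /J' nagataK.
move/eqP: (Jb _ Jng) => E; case/eqP; rewrite -{}E.
symmetry; apply: (mpoly_rmorph_ext (u := horner_eval b \o map_poly (meval a) \o nagata e)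
  (v := meval (fun i => (nagata_base K i).@[a] + b ^+ (e ^ i)))) => [x|i] /=.
  by rewrite nagataC map_polyC /= /horner_eval hornerC !mevalC.
rewrite [nagata e _]mmapX mmap1U rmorphD /= map_polyC map_polyXn.
by rewrite /horner_eval hornerD hornerC hornerXn mevalXU.
Qed.

(** * Homogeneous ideals without zeros *)

Section HomogeneousIdeals.
Variables (K : fieldType) (n : nat) (mf : measure n).
Implicit Types (p q : {mpoly K[n]}).

Lemma mcoeff_pihomog d p m : (pihomog mf d p)@_m = if mf m == d then p@_m else 0.
Proof.
pose l := maxn (msize p) (mdeg m).+1.
rewrite (@pihomogwE _ _ mf d l) ?leq_maxl // big_mkcond /=.
rewrite (eq_bigr (fun m : 'X_{1..n < l} => (if mf m == d then p@_m else 0) *: 'X_[m])).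
  by rewrite (mcoeff_mpoly (fun m => if mf m == d then p@_m else 0)) // leq_maxr.
by move=> m' _; case: ifP => // _; rewrite scale0r.
Qed.

Lemma pihomogMr d e p q : q \is e.-homog for mf ->
  pihomog mf (d + e) (p * q) = pihomog mf d p * q.
Proof.
move=> hq; rewrite {1}(pihomog_partitionE (leqnn (mmeasure mf p))) mulr_suml linear_sum /=.
pose F b := if b == d then pihomog mf d p * q else 0.
rewrite (eq_bigr (fun b => F (val b))) => [|b _]; last first.
  rewrite /F; have hb : pihomog mf b p * q \is (b + e).-homog for mf.
    by apply: dhomogM hq; exact: pihomogP.
  case: eqP => [<-|/eqP bd]; first exact: pihomog_dE.
  by apply: pihomog_ne0 hb; rewrite eqn_add2r.
have [dp|pd] := ltnP d (mmeasure mf p).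
  rewrite (bigD1 (Ordinal dp)) //= big1 ?addr0 /F ?eqxx // => i /negPf.
  by rewrite -val_eqE /= => ->.
rewrite big1 => [|i _]; last first.
  by rewrite /F; case: eqP => // id; have := ltn_ord i; rewrite id ltnNge pd.
rewrite (_ : pihomog _ _ _ = 0) ?mul0r //; apply/mpolyP => m; rewrite mcoeff_pihomog mcoeff0.
by case: eqP => // md; apply/eqP; rewrite mcoeff_eq0 (mmeasure_mnm_ge (mf := mf)) // md.
Qed.

Lemma pihomogMr_small d e p q : q \is e.-homog for mf -> (d < e)%N ->
  pihomog mf d (p * q) = 0.
Proof.
move=> /dhomogP hq de; apply/mpolyP => m; rewrite mcoeff_pihomog mcoeff0.
case: eqP => // md; apply/eqP; rewrite mcoeff_eq0; apply/negP => /msuppM_le.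
case/allpairsP => -[m1 m2] /= [_ m2q mE]; move: de.
by rewrite -md mE mfD (hq _ m2q) ltnNge leq_addl.
Qed.

Section Generators.
Variables (I : finType) (F : I -> {mpoly K[n]}) (e : I -> nat).
Hypothesis homF : forall j, F j \is (e j).-homog for mf.

Definition gen_ideal p := exists G : I -> {mpoly K[n]}, p = \sum_j G j * F j.

Lemma gen_ideal_ideal : is_ideal gen_ideal.
Proof.
split.
- by exists (fun=> 0); rewrite big1 // => j _; rewrite mul0r.
- move=> _ _ [G ->] [H ->]; exists (fun j => G j + H j).
  by rewrite -big_split; apply: eq_bigr => j _; rewrite mulrDl.
- move=> c _ [G ->]; exists (fun j => c * G j).
  by rewrite mulr_sumr; apply: eq_bigr => j _; rewrite mulrA.
Qed.

Lemma gen_ideal_mem j : gen_ideal (F j).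
Proof.
exists (fun i => (i == j)%:R).
by rewrite (bigD1 j) //= eqxx mul1r big1 ?addr0 // => i /negPf ->; rewrite mul0r.
Qed.

(** Keep in each coefficient the component of the complementary degree.  The first
    clause says that [G j] has degree [d - e j], or is 0 if [d < e j], in the form
    needed to replace [F j] by another polynomial of the same degree. *)
Lemma gen_ideal_pihomog d p : gen_ideal p -> exists2 G : I -> {mpoly K[n]},
  forall j q, q \is (e j).-homog for mf -> G j * q \is d.-homog for mf
  & pihomog mf d p = \sum_j G j * F j.
Proof.
case=> G ->; exists (fun j => if (e j <= d)%N then pihomog mf (d - e j) (G j) else 0).
  move=> j q hq; case: leqP => [ed|_]; last by rewrite mul0r dhomog0.
  by rewrite -[X in X.-homog for mf](subnK ed); apply: dhomogM hq; exact: pihomogP.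
rewrite linear_sum; apply: eq_bigr => j _; case: leqP => [ed|de].
  exact: etrans (congr1 (fun a => pihomog mf a _) (esym (subnK ed))) (pihomogMr _ _ (homF j)).
by rewrite mul0r /= (pihomogMr_small _ (homF j)).
Qed.

End Generators.
End HomogeneousIdeals.

Section HomogeneousZeros.
Variables (K : closedFieldType) (n : nat) (mf : measure n).
Hypothesis mf_gt0 : forall i, (0 < mf U_(i)%MM)%N.
Variables (I : finType) (F : I -> {mpoly K[n]}) (e : I -> nat).
Hypothesis homF : forall j, F j \is (e j).-homog for mf.
Hypothesis F_nozero : forall x, (exists i, x i != 0) -> exists j, (F j).@[x] != 0.

Let J := gen_ideal F.
Let idJ : is_ideal J := gen_ideal_ideal F.

(** Adding [X_i = 1] to the equations leaves no zero, hence [1 = g + q (X_i - 1)]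
    with [g] in [J].  Degree by degree this determines [q] modulo [J]: its component
    of degree [s w] is [- X_i ^ s], and vanishes for large [s]. *)
Lemma homog_var_nilpotent i : exists s, J ('X_i ^+ s).
Proof.
pose J1 p := exists2 g, J g & exists q, p = g + q * ('X_i - 1).
have [g Jg [q E]] : J1 1.
  apply: weak_nullstellensatz => [|x].
    split.
    - by exists 0; [exact: ideal0|exists 0; rewrite mul0r addr0].
    - move=> _ _ [g Jg [q ->]] [h Jh [r ->]]; exists (g + h); first exact: idealD.
      by exists (q + r); rewrite mulrDl addrACA.
    - move=> c _ [g Jg [q ->]]; exists (c * g); first exact: idealMl.
      by exists (c * q); rewrite mulrDr mulrA.
  have [x1|x1] := eqVneq (x i) 1.
    have [|j Fj] := F_nozero (x := x); first by exists i; rewrite x1 oner_neq0.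
    exists (F j) => //; exists (F j); first exact: gen_ideal_mem.
    by exists 0; rewrite mul0r addr0.
  exists ('X_i - 1); last by rewrite mevalB mevalXU meval1 subr_eq0.
  by exists 0; [exact: ideal0|exists 1; rewrite mul1r add0r].
pose w := mf U_(i)%MM.
have hX : ('X_i : {mpoly K[n]}) \is w.-homog for mf by rewrite dhomogX.
have Jpi d h : J h -> J (pihomog mf d h).
  by move=> /(gen_ideal_pihomog homF d)[G _ ->]; exists G.
have key s : J ('X_i ^+ s + pihomog mf (s * w) q).
  elim: s => [|s IHs].
    have := congr1 (pihomog mf 0) E; rewrite mulrBr mulr1 linearD linearB /=.
    rewrite (pihomogMr_small _ hX) ?mf_gt0 // sub0r.
    rewrite pihomog_dE ?dhomog1 // mul0n expr0 => ->.
    by rewrite subrK; exact: Jpi.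
  have := congr1 (pihomog mf (s.+1 * w)) E; rewrite mulrBr mulr1 linearD linearB /=.
  rewrite (@pihomog_ne0 _ _ _ 0%N) ?dhomog1 //; last by rewrite eq_sym muln_eq0 -lt0n mf_gt0.
  rewrite mulSn [(w + s * w)%N]addnC (pihomogMr _ _ hX) => /esym/eqP.
  rewrite addrA subr_eq0 => /eqP <-.
  rewrite addrCA exprSr -mulrDl; apply: (idealD idJ); first exact: Jpi.
  by rewrite mulrC; apply: (idealMl idJ).
exists (mmeasure mf q); have := key (mmeasure mf q).
rewrite (_ : pihomog _ _ _ = 0) ?addr0 //; apply/mpolyP => m; rewrite mcoeff_pihomog mcoeff0.
case: eqP => // md; apply/eqP; rewrite mcoeff_eq0 (mmeasure_mnm_ge (mf := mf)) // md.
by rewrite leq_pmulr // mf_gt0.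
Qed.

(** A monomial of large degree contains a large power of one variable. *)
Lemma homog_nullstellensatz : exists N, forall m : 'X_{1..n}, (N <= mdeg m)%N -> J 'X_[m].
Proof.
have [s Js] : exists s : 'I_n -> nat, forall i, J ('X_i ^+ s i).
  exact: fin_all_exists homog_var_nilpotent.
exists (\sum_i s i).+1 => m; rewrite mdegE => sm.
have [i si] : exists i, (s i <= m i)%N.
  apply/existsP; apply: contraTT sm; rewrite negb_exists -leqNgt => /forallP H.
  by apply: leq_sum => i _; have := H i; rewrite -ltnNge; exact: ltnW.
rewrite mpolyXE_id (bigD1 i) //= mulrC -(subnK si) exprD mulrA.
exact: (idealMl idJ).
Qed.

End HomogeneousZeros.

(** * Zeros do not disappear in deformations *)

Lemma ideal_det_fin (B : comNzRingType) (J : B -> Prop) (T : finType)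
    (M : T -> T -> B) (v : T -> B) :
  is_ideal J -> (forall x, J (\sum_y M x y * v y)) ->
  forall x, J (\det (\matrix_(a < #|T|, b < #|T|) M (enum_val a) (enum_val b)) * v x).
Proof.
move=> idJ JM x; set M' := (\matrix_(a, b) _).
have /(ideal_det idJ (v := v \o enum_val))/(_ (enum_rank x)) :
    forall a, J (\sum_b M' a b * v (enum_val b)).
  move=> a; congr J: (JM (enum_val a)).
  rewrite -(eq_bigl _ _ (fun y => erefl : (y \in T) = true)) big_enum_val.
  by apply: eq_bigr => b _; rewrite mxE.
by rewrite /= enum_rankK.
Qed.

Section Persistence.
Variables (K : closedFieldType) (n : nat) (mf : measure n).
Hypothesis mf_gt0 : forall i, (0 < mf U_(i)%MM)%N.
Variables (I : finType) (e : I -> nat) (F0 F1 F2 : I -> {mpoly K[n]}).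
Hypothesis hom0 : forall j, F0 j \is (e j).-homog for mf.
Hypothesis hom1 : forall j, F1 j \is (e j).-homog for mf.
Hypothesis hom2 : forall j, F2 j \is (e j).-homog for mf.
Hypothesis F0_nozero : forall x, (exists i, x i != 0) -> exists j, (F0 j).@[x] != 0.
Variable i0 : 'I_n.

Local Notation ev := (mmap (@polyC K)).

Lemma mdeg_le_measure (m : 'X_{1..n}) : (mdeg m <= mf m)%N.
Proof.
rewrite mdegE (mfE mf); apply: leq_sum => i _.
by rewrite leq_pmulr // mf_gt0.
Qed.

Lemma measure_le_mdeg (m : 'X_{1..n}) : (mf m <= mdeg m * \sum_i mf U_(i)%MM)%N.
Proof.
rewrite mdegE (mfE mf) big_distrl; apply: leq_sum => i _.
by rewrite leq_mul2l; apply/orP; right; rewrite (bigD1 i) //= leq_addr.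
Qed.

Lemma homog_msize_le d (p : {mpoly K[n]}) : p \is d.-homog for mf -> (msize p <= d.+1)%N.
Proof.
move=> /dhomogP hp; rewrite msizeE; apply/bigmax_leqP_seq => m mp _.
by rewrite ltnS -(hp _ mp) mdeg_le_measure.
Qed.

(** In a suitable degree [d] every monomial is a combination of the [F0 j].
    Evaluated at an approximate zero [p] of the perturbed system, these relations
    read [v = - (u E1 + u ^+ 2 E2) v] for the vector [v] of the values of the
    monomials.  The determinant of [1 + u E1 + u ^+ 2 E2] depends neither on [p] nor
    on its precision, is 1 at the point 1 where [u] vanishes, and kills [v], whose
    entry at the powers of [X_i0] is 1. *)
Lemma no_formal_zero (u : {poly K}) : u.[1] = 0 ->
  (forall N, exists2 p : 'I_n -> {poly K}, p i0 = 1 &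
    forall j, 'X^N %| ev p (F0 j) + u * ev p (F1 j) + u ^+ 2 * ev p (F2 j)) -> False.
Proof.
move=> u1 path.
have [N0 HN0] := homog_nullstellensatz mf_gt0 hom0 F0_nozero.
pose w := (\sum_i mf U_(i)%MM)%N.
have w0 : (0 < w)%N.
  by rewrite /w (bigD1 i0) //= (leq_trans (mf_gt0 i0)) // leq_addr.
(* A multiple of the degree of [X_i0], large enough for the monomials of weighted
   degree [d] to have degree at least [N0]. *)
pose d := (N0 * w * mf U_(i0)%MM)%N.
have Jd m : mf m = d -> gen_ideal F0 'X_[m].
  move=> md; apply: HN0; have := measure_le_mdeg m; rewrite md -/w => H.
  rewrite -(leq_pmul2r w0) (leq_trans _ H) // leq_pmulr //; exact: mf_gt0.
pose P (m : 'X_{1..n < d.+1}) (G : I -> {mpoly K[n]}) := mf m = d ->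
  (forall j q, q \is (e j).-homog for mf -> G j * q \is d.-homog for mf)
  /\ 'X_[m] = \sum_j G j * F0 j.
have [G HG] : exists G, forall m, P m (G m).
  apply: fin_all_exists => m; have [md|md] := eqVneq (mf m) d; last first.
    by exists (fun=> 0) => E; rewrite E eqxx in md.
  have [G GH GE] := gen_ideal_pihomog hom0 d (Jd _ md); exists G => _; split=> //.
  by rewrite -GE pihomog_dE // dhomogX md.
pose T : finType := 'X_{1..n < d.+1}.
pose R (F : I -> {mpoly K[n]}) (m m' : T) : K :=
  if mf m == d then (\sum_j G m j * F j)@_m' else 0.
pose M (m m' : T) := (m == m')%:R + u * (R F1 m m')%:P + u ^+ 2 * (R F2 m m')%:P.
pose D := \det (\matrix_(a < #|T|, b < #|T|) M (enum_val a) (enum_val b)).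
have detM : D.[1] = 1.
  rewrite -[LHS]/(horner_eval 1 D) -det_map_mx (_ : map_mx _ _ = 1%:M) ?det1 //.
  apply/matrixP => a b; rewrite !mxE -[LHS]/((M (enum_val a) (enum_val b)).[1]) /M.
  rewrite !hornerE u1 mul0r addr0 expr0n mul0r addr0.
  by rewrite (inj_eq enum_val_inj); case: (a == b); rewrite ?hornerC.
have detM0 : D != 0.
  by apply/eqP => E; move: detM; rewrite E horner0 => /esym/eqP; rewrite oner_eq0.
have [p pi0 Hp] := path (size D).
(* Both [v] and the rows of [R] are 0 outside weighted degree [d], so that the
   indices may range over all monomials of bounded degree. *)
pose v (m : T) := if mf m == d then ev p 'X_[m] else 0.
have evE q : q \is d.-homog for mf -> ev p q = \sum_(m : T) (q@_m)%:P * v m.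
  move=> hq; rewrite (mmapE d.+1) ?homog_msize_le //; apply: eq_bigr => m _.
  rewrite /v mmapX; case: eqP => // md.
  by rewrite (dhomog_nemf_coeff hq) ?polyC0 ?mul0r //; apply/eqP.
have idN : is_ideal (fun q : {poly K} => 'X^(size D) %| q).
  by split=> [|a b|c a]; [exact: dvdp0|exact: dvdp_add|exact: dvdp_mull].
have rowP m : 'X^(size D) %| \sum_m' M m m' * v m'.
  have -> : \sum_m' M m m' * v m' =
      v m + u * (\sum_m' (R F1 m m')%:P * v m') + u ^+ 2 * (\sum_m' (R F2 m m')%:P * v m').
    rewrite /M !mulr_sumr.
    rewrite [X in X + _ + _](_ : _ = \sum_m' (m == m')%:R * v m'); last first.
      rewrite (bigD1 m) //= eqxx mul1r big1 ?addr0 // => m' /negPf.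
      by rewrite eq_sym => ->; rewrite mul0r.
    by rewrite -!big_split /=; apply: eq_bigr => m' _; rewrite !mulrDl !mulrA.
  rewrite /v /R; case: eqP => [md|_]; last first.
    by rewrite !big1 ?mulr0 ?addr0 ?dvdp0 // => m' _; rewrite mul0r.
  have [GH GE] := HG m md.
  have hsum F : (forall j, F j \is (e j).-homog for mf) -> \sum_j G m j * F j \is d.-homog for mf.
    by move=> hF; apply: rpred_sum => j _; exact: GH.
  rewrite -!evE ?hsum // GE !rmorph_sum /= !mulr_sumr -!big_split /=.
  apply: (ideal_sum idN) => j _; rewrite !rmorphM /=.
  rewrite (_ : _ + _ = ev p (G m j) * (ev p (F0 j) + u * ev p (F1 j) + u ^+ 2 * ev p (F2 j))).
    exact: (idealMl idN).
  by rewrite !mulrDr !(mulrCA _ (ev p (G m j))).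
pose m0 : 'X_{1..n} := (U_(i0) *+ (N0 * w))%MM.
have m0d : mf m0 = d.
  rewrite /m0 /d; elim: (N0 * w)%N => [|s IHs]; first by rewrite mulm0n mf0.
  by rewrite mulmS mfD IHs mulSn.
have m0T : (mdeg m0 < d.+1)%N by rewrite ltnS -m0d mdeg_le_measure.
have := ideal_det_fin idN rowP (BMultinom m0T).
rewrite /v /= m0d eqxx -mpolyXn rmorphXn /= mmapX mmap1U pi0 expr1n mulr1 => H.
by have := dvdp_leq detM0 H; rewrite size_polyXn ltnn.
Qed.

End Persistence.

(** * Formal zeros *)

Section Congruence.
Variable K : fieldType.
Local Notation P := {poly K}.
Local Notation "x =_ N y" := (is_true ('X^N %| (x - y : P)))
  (at level 70, N at level 2, y at next level).

Lemma cong_refl N (x : P) : x =_N x.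
Proof. by rewrite subrr dvdp0. Qed.

Lemma congD N (x y x' y' : P) : x =_N y -> x' =_N y' -> x + x' =_N y + y'.
Proof. by move=> h h'; rewrite opprD addrACA dvdp_add. Qed.

Lemma congN N (x y : P) : x =_N y -> - x =_N - y.
Proof. by move=> h; rewrite -opprD dvdpNr. Qed.

Lemma congM N (x y x' y' : P) : x =_N y -> x' =_N y' -> x * x' =_N y * y'.
Proof.
move=> h h'; rewrite (_ : _ - _ = (x - y) * x' + y * (x' - y')); last by ring.
by apply: dvdp_add; [exact: dvdp_mulr|exact: dvdp_mull].
Qed.

Lemma cong_mmap n N (z z' : 'I_n -> P) (q : {mpoly K[n]}) :
  (forall i, z i =_N z' i) -> mmap (@polyC K) z q =_N mmap (@polyC K) z' q.
Proof.
move=> h; rewrite /mmap -sumrB big_seq; apply: (big_ind (fun x => 'X^N %| x)) => [|x y|m _].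
- exact: dvdp0.
- exact: dvdp_add.
apply: congM; first exact: cong_refl.
rewrite /mmap1; elim/big_rec2: _ => [|i x' y' _ xy']; first exact: cong_refl.
apply: congM xy'; elim: (m i) => [|e IHe]; first exact: cong_refl.
by rewrite !exprS; apply: congM.
Qed.

(** Each iteration of [z |-> 'X * r z], from 0, gains one power of ['X]. *)
Lemma formal_fixpoint n (r : ('I_n -> P) -> 'I_n -> P) :
  (forall N z z', (forall i, z i =_N z' i) -> forall i, r z i =_N r z' i) ->
  forall N, exists z, forall i, z i =_N 'X * r z i.
Proof.
move=> rC; elim=> [|N [z IHz]]; first by exists (fun=> 0) => i; rewrite expr0 dvd1p.
exists (fun i => 'X * r z i) => i; rewrite -mulrBr exprS dvdp_mul //; exact: rC.
Qed.

End Congruence.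

(** The minors with index [s] generate all others up to the factors [ph s] and
    [al s].  Among them, the one with index [i0] follows from the rest: Euler's
    relations express the combination of these minors with coefficients [w i * p i]
    through [f], and [i0] has coefficient 1. *)
Lemma pivot_minors (B : comNzRingType) (J : B -> Prop) n (w p al ph : 'I_n -> B)
    (f c : B) (i0 s : 'I_n) :
  is_ideal J -> w i0 * p i0 = 1 ->
  \sum_i w i * p i * al i = 0 -> \sum_i w i * p i * ph i = c * f -> J f ->
  (forall i, i != i0 -> i != s -> J (al i * ph s - al s * ph i)) ->
  forall i j, J (ph s * (al i * ph j - al j * ph i)) /\ J (al s * (al i * ph j - al j * ph i)).
Proof.
move=> idJ wp0 eA eF Jf Js.
have Js' i : i != i0 -> J (al i * ph s - al s * ph i).
  have [->|ns ni] := eqVneq i s; last exact: Js.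
  by rewrite mulrC subrr => _; exact: ideal0.
have J0 : J (al i0 * ph s - al s * ph i0).
  have E : \sum_i w i * p i * (al i * ph s - al s * ph i) = - (al s * c * f).
    transitivity (\sum_i w i * p i * al i * ph s - \sum_i al s * (w i * p i * ph i)).
      by rewrite -sumrB; apply: eq_bigr => i _; ring.
    by rewrite -mulr_suml -mulr_sumr eA eF; ring.
  move: E; rewrite (bigD1 i0) //= wp0 mul1r => /(canRL (addrK _)) ->.
  apply: (idealB idJ); first by rewrite -mulNr; exact: (idealMl idJ).
  by apply: (ideal_sum idJ) => i ni; apply: (idealMl idJ); exact: Js'.
have {Js' J0}Js' i : J (al i * ph s - al s * ph i).
  by have [->|] := eqVneq i i0; last exact: Js'.
move=> i j; split.
  rewrite (_ : _ * _ = ph j * (al i * ph s - al s * ph i)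
    - ph i * (al j * ph s - al s * ph j)); last by ring.
  by apply: (idealB idJ); exact: (idealMl idJ).
rewrite (_ : _ * _ = al j * (al i * ph s - al s * ph i)
  - al i * (al j * ph s - al s * ph j)); last by ring.
by apply: (idealB idJ); exact: (idealMl idJ).
Qed.

(** * Quasi-homogeneous forms and pencils *)

Section Identities.
Variable B : comNzRingType.
Implicit Types (a b x y t : B).

Lemma affine_pencil t a b : b + t * (a - b) = a + (1 - t) * (b - a) + (1 - t) ^+ 2 * 0.
Proof. by ring. Qed.

(** The expansion of a minor of the pencil at [t = 1]; [affine_pencil] puts the
    equation itself in the same shape, and [minor_pencil0] expands at [t = 0]. *)
Lemma minor_pencil t a1 a2 b1 b2 x1 x2 y1 y2 :
  (b1 + t * (a1 - b1)) * (y2 + t * (x2 - y2)) - (b2 + t * (a2 - b2)) * (y1 + t * (x1 - y1))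
  = a1 * x2 - a2 * x1
    + (1 - t) * (a1 * (y2 - x2) - a2 * (y1 - x1) + ((b1 - a1) * x2 - (b2 - a2) * x1))
    + (1 - t) ^+ 2 * ((b1 - a1) * (y2 - x2) - (b2 - a2) * (y1 - x1)).
Proof. by ring. Qed.

Lemma minor_pencil0 t a1 a2 b1 b2 x1 x2 y1 y2 :
  (b1 + t * (a1 - b1)) * (y2 + t * (x2 - y2)) - (b2 + t * (a2 - b2)) * (y1 + t * (x1 - y1))
  = b1 * y2 - b2 * y1
    + t * (b1 * (x2 - y2) + (a1 - b1) * y2 - b2 * (x1 - y1) - (a2 - b2) * y1
           + t * ((a1 - b1) * (x2 - y2) - (a2 - b2) * (x1 - y1))).
Proof. by ring. Qed.

Lemma scaled_pencil t c a b : c * (b + t * (a - b)) = c * b + t * (c * a - c * b).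
Proof. by ring. Qed.

End Identities.

Section WeightedForms.
Variables (K : fieldType) (k : nat).
Local Notation ev := (mmap (@polyC K)).
Implicit Types (f g q : {mpoly K[5]}) (A : 'I_5 -> {mpoly K[5]}).

Local Notation qhomog d g := (g \is d.-homog for (wdeg k)).

(** The condition [twisted_form] over any field; over [complex R] the two are
    convertible. *)
Definition weighted_form d A :=
  (forall i, qhomog d (A i * 'X_i)) /\ \sum_(i < 5) (A i * 'X_i) *+ weight k i = 0.

Lemma qhomogP d q : reflect (forall m, m \in msupp q -> wdeg k m = d) (qhomog d q).
Proof. exact: dhomogP. Qed.

Lemma wdegU i : wdeg k U_(i)%MM = weight k i.
Proof.
rewrite /wdeg (bigD1 i) //= mnm1E eqxx muln1 big1 ?addn0 // => j /negPf ji.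
by rewrite mnm1E eq_sym ji muln0.
Qed.

Lemma wdeg_shift d q m i : qhomog d (q * 'X_i) -> m \in msupp q ->
  (wdeg k m + weight k i)%N = d.
Proof.
move=> /qhomogP H mq; rewrite -wdegU -wdegD; apply: H.
by rewrite mcoeff_msupp addmC mcoeffMX -mcoeff_msupp.
Qed.

(** Where the subtraction truncates, the product is 0 and has every degree. *)
Lemma qhomog_prod_shift d a q g i j : qhomog d (q * 'X_i) -> qhomog a (g * 'X_j) ->
  qhomog (d + a - (weight k i + weight k j)) (q * g).
Proof.
move=> hq hg; apply/qhomogP => m /msuppM_le /allpairsP[[m1 m2] /= [m1q m2g ->]].
rewrite wdegD -(wdeg_shift hq m1q) -(wdeg_shift hg m2g) addnACA.
by rewrite addnK.
Qed.

Lemma qhomog_deriv a f i : qhomog a f -> qhomog a (f^`M(i) * 'X_i).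
Proof.
move=> /qhomogP H; apply/qhomogP => m /msuppM_le /allpairsP[[m1 m2] /= [m1f]].
rewrite msuppX inE => /eqP -> ->; apply: H; move: m1f; rewrite !mcoeff_msupp mcoeff_deriv.
by apply: contraNneq => ->; rewrite mul0rn.
Qed.

Lemma euler_identity a f : qhomog a f ->
  \sum_(i < 5) (f^`M(i) * 'X_i) *+ weight k i = f *+ a.
Proof.
move=> /qhomogP hf.
have term i : f^`M(i) * 'X_i = \sum_(m <- msupp f) f@_m *: 'X_[m] *+ m i.
  rewrite {1}(mpolyE f) linear_sum mulr_suml; apply: eq_bigr => m _ /=.
  rewrite mderivZ mderivX -scalerAl -scalerAl -mpolyXD.
  case E : (m i) => [|s]; first by rewrite mulr0n scale0r scaler0.
  rewrite submK; first by rewrite scalerMnr scaler_nat.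
  by rewrite lep1mP E.
under eq_bigr do rewrite term -sumrMnl.
rewrite exchange_big /= [in RHS](mpolyE f) -sumrMnl big_seq [RHS]big_seq.
apply: eq_bigr => m mf; rewrite -(hf _ mf) /wdeg -sumrMnr.
by apply: eq_bigr => i _; rewrite -mulrnA mulnC.
Qed.

Lemma weighted_formB d A A' : weighted_form d A -> weighted_form d A' ->
  forall i, qhomog d ((A i - A' i) * 'X_i).
Proof.
by move=> [hA _] [hA' _] i; rewrite mulrBl; apply: rpredB; [exact: hA|exact: hA'].
Qed.

Lemma evM (p : 'I_5 -> {poly K}) g q : ev p (g * q) = ev p g * ev p q.
Proof. exact: rmorphM. Qed.

Lemma evD (p : 'I_5 -> {poly K}) g q : ev p (g + q) = ev p g + ev p q.
Proof. exact: rmorphD. Qed.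

Lemma evB (p : 'I_5 -> {poly K}) g q : ev p (g - q) = ev p g - ev p q.
Proof. exact: rmorphB. Qed.

Lemma ev_sum (p : 'I_5 -> {poly K}) (F : 'I_5 -> {mpoly K[5]}) :
  ev p (\sum_i F i) = \sum_i ev p (F i).
Proof. exact: raddf_sum. Qed.

Lemma evX (p : 'I_5 -> {poly K}) i : ev p 'X_i = p i.
Proof. by rewrite mmapX mmap1U. Qed.

(** The value at [p] of the segment that goes from [g'] at ['X = 0] to [g] at
    ['X = 1]. *)
Definition pencil p g g' : {poly K} := ev p g' + 'X * (ev p g - ev p g').

Section Euler.
Variables (a d : nat) (f f' : {mpoly K[5]}) (A A' : 'I_5 -> {mpoly K[5]}).
Hypotheses (hf : qhomog a f) (hf' : qhomog a f').
Hypotheses (hA : weighted_form d A) (hA' : weighted_form d A').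

(** A pivot with nonzero constant term is invertible modulo ['X^N], so the equation
    and three minors suffice: as many conditions as there are affine coordinates. *)
Lemma pivot_pencil_minors p N (s : 'I_5) : p ord0 = 1 -> s != ord0 ->
  'X^N %| pencil p f f' ->
  (forall i, i != ord0 -> i != s ->
     'X^N %| pencil p (A i) (A' i) * pencil p f^`M(s) f'^`M(s)
           - pencil p (A s) (A' s) * pencil p f^`M(i) f'^`M(i)) ->
  (pencil p (A s) (A' s)).[0] != 0 \/ (pencil p f^`M(s) f'^`M(s)).[0] != 0 ->
  forall i j,
     'X^N %| pencil p (A i) (A' i) * pencil p f^`M(j) f'^`M(j)
           - pencil p (A j) (A' j) * pencil p f^`M(i) f'^`M(i).
Proof.
move=> p0 s0 pf pm piv i j.
have idN : is_ideal (fun q : {poly K} => 'X^N %| q).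
  by split=> [|x y|c x]; [exact: dvdp0|exact: dvdp_add|exact: dvdp_mull].
have evsum (g : 'I_5 -> {mpoly K[5]}) :
    ev p (\sum_(i < 5) (g i * 'X_i) *+ weight k i) = \sum_i (weight k i)%:R * p i * ev p (g i).
  rewrite ev_sum; apply: eq_bigr => l _.
  by rewrite mmapMn evM evX -mulr_natl [ev p _ * _]mulrC mulrA.
have wsum (g g' : 'I_5 -> {mpoly K[5]}) q q' :
    \sum_(i < 5) (g i * 'X_i) *+ weight k i = q ->
    \sum_(i < 5) (g' i * 'X_i) *+ weight k i = q' ->
    \sum_i (weight k i)%:R * p i * pencil p (g i) (g' i) = pencil p q q'.
  move=> <- <-; rewrite /pencil (evsum g) (evsum g') -sumrB mulr_sumr -big_split /=.
  by apply: eq_bigr => l _; exact: scaled_pencil.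
have eA : \sum_i (weight k i)%:R * p i * pencil p (A i) (A' i) = 0.
  apply: etrans (wsum A A' 0 0 _ _) _; [by case: hA|by case: hA'|].
  by rewrite /pencil mmap0 subrr mulr0 addr0.
have eF : \sum_i (weight k i)%:R * p i * pencil p f^`M(i) f'^`M(i) = a%:R * pencil p f f'.
  apply: etrans (wsum _ _ _ _ (euler_identity hf) (euler_identity hf')) _.
  by rewrite /pencil !mmapMn scaled_pencil !mulr_natl.
have w0 : (weight k ord0)%:R * p ord0 = 1 by rewrite p0 mulr1.
have [J1 J2] := @pivot_minors _ _ 5 (fun i => (weight k i)%:R) p
  (fun i => pencil p (A i) (A' i)) (fun i => pencil p f^`M(i) f'^`M(i)) _ _ _ _
  idN w0 eA eF pf pm i j.
have cancel (c q : {poly K}) : c.[0] != 0 -> 'X^N %| c * q -> 'X^N %| q.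
  move=> c0; rewrite Gauss_dvdpr // coprimep_sym coprimep_expr //.
  by rewrite coprimepX.
by case: piv => /cancel; apply; [exact: J2|exact: J1].
Qed.

End Euler.

End WeightedForms.

Section Deformation.
Variables (K : closedFieldType) (k : nat).
Hypothesis k_gt0 : (0 < k)%N.
Local Notation qhomog d g := (g \is d.-homog for (wdeg k)).
Variables (a d : nat) (f f' : {mpoly K[5]}) (A A' : 'I_5 -> {mpoly K[5]}).
Hypotheses (hf : qhomog a f) (hf' : qhomog a f').
Hypotheses (hA : weighted_form k d A) (hA' : weighted_form k d A').
Hypothesis nozero : forall x, (exists i, x i != 0) ->
  f.@[x] != 0 \/ exists i j, (A i * f^`M(j) - A j * f^`M(i)).@[x] != 0.

(** The system consists of the equation, with index [None], and of the minors. *)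
Lemma no_formal_deformation :
  ~ (forall N, exists2 p, p ord0 = 1 & 'X^N %| pencil p f f' /\ forall i j,
     'X^N %| pencil p (A i) (A' i) * pencil p f^`M(j) f'^`M(j)
           - pencil p (A j) (A' j) * pencil p f^`M(i) f'^`M(i)).
Proof.
move=> path.
pose h := f' - f; pose B i := A' i - A i.
have hB i : qhomog d (B i * 'X_i) by exact: weighted_formB.
have hAi i : qhomog d (A i * 'X_i) by case: hA.
have hh : qhomog a h by exact: rpredB.
pose minor (A : 'I_5 -> {mpoly K[5]}) f (i j : 'I_5) := A i * f^`M(j) - A j * f^`M(i).
have hminor (E : 'I_5 -> {mpoly K[5]}) g i j :
    (forall i, qhomog d (E i * 'X_i)) -> qhomog a g ->
    qhomog (d + a - (weight k i + weight k j)) (minor E g i j).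
  move=> hE hg; apply: rpredB; first exact: qhomog_prod_shift (hE i) (qhomog_deriv _ hg).
  by rewrite [(weight k i + _)%N]addnC; exact: qhomog_prod_shift (hE j) (qhomog_deriv _ hg).
pose I : finType := option ('I_5 * 'I_5).
pose e (x : I) := if x is Some (i, j) then (d + a - (weight k i + weight k j))%N else a.
pose F0 (x : I) := if x is Some (i, j) then minor A f i j else f.
pose F1 (x : I) := if x is Some (i, j) then minor A h i j + minor B f i j else h.
pose F2 (x : I) := if x is Some (i, j) then minor B h i j else 0.
apply: (@no_formal_zero K 5 (wdeg k) _ I e F0 F1 F2 _ _ _ _ ord0 (1 - 'X)).
- move=> i; suff: (0 < wdeg k U_(i)%MM)%N by [].
  by rewrite wdegU /weight; case: ifP.
- by case=> [[i j]|] //=; exact: hminor.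
- by case=> [[i j]|] //=; apply: rpredD; exact: hminor.
- case=> [[i j]|] /=; [exact: hminor|exact: dhomog0].
- move=> x /nozero[fx|[i [j mx]]]; [by exists None|by exists (Some (i, j))].
- by rewrite hornerD hornerN hornerX hornerC subrr.
move=> N; have [p p0 [pf pm]] := path N; exists p => // -[[i j]|] /=.
  congr (is_true (_ %| _)): (pm i j).
  rewrite /minor /pencil /h /B !mderivB.
  by rewrite !(evB, evD, evM); exact: minor_pencil.
congr (is_true (_ %| _)): pf.
by rewrite /pencil /h evB mmap0; exact: affine_pencil.
Qed.

End Deformation.

(** * Special pairs with a nondegenerate zero *)

Local Notation o1 := (@Ordinal 5 1 isT).
Local Notation o2 := (@Ordinal 5 2 isT).
Local Notation o3 := (@Ordinal 5 3 isT).
Local Notation o4 := (@Ordinal 5 4 isT).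

Lemma ord5_ind (P : 'I_5 -> Prop) : P ord0 -> P o1 -> P o2 -> P o3 -> P o4 -> forall i, P i.
Proof.
move=> P0 P1 P2 P3 P4 [m mP]; move: m mP => [|[|[|[|[|//]]]]] mP.
- by rewrite (_ : Ordinal mP = ord0) //; exact: val_inj.
- by rewrite (_ : Ordinal mP = o1) //; exact: val_inj.
- by rewrite (_ : Ordinal mP = o2) //; exact: val_inj.
- by rewrite (_ : Ordinal mP = o3) //; exact: val_inj.
- by rewrite (_ : Ordinal mP = o4) //; exact: val_inj.
Qed.

Lemma sum5 (V : nmodType) (F : 'I_5 -> V) :
  \sum_i F i = F ord0 + F o1 + F o2 + F o3 + F o4.
Proof.
rewrite !big_ord_recl big_ord0 addr0 !addrA.
by do !congr (_ + _); congr F; apply: val_inj.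
Qed.

Lemma mderivXU (K : comNzRingType) n (i j : 'I_n) : ('X_j : {mpoly K[n]})^`M(i) = (j == i)%:R.
Proof.
rewrite mderivX mnm1E; case: eqP => [->|_]; last by rewrite scale0r.
rewrite (_ : (U_(i) - U_(i))%MM = 0%MM) ?mpolyX0 ?scale1r //.
by apply/mnmP => l; rewrite mnmBE mnm0E subnn.
Qed.

Lemma mderivMX_other (K : comNzRingType) n (i j : 'I_n) b (q : {mpoly K[n]}) : j != i ->
  (q * 'X_j ^+ b)^`M(i) = q^`M(i) * 'X_j ^+ b.
Proof.
move=> ji; rewrite mderivM mpolyXn mderivX mulmnE mnm1E (negPf ji) mul0n scale0r mulr0.
by rewrite addr0.
Qed.

Section SpecialPairs.
Variables (K : fieldType) (k : nat).
Hypothesis k_gt0 : (0 < k)%N.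
Local Notation ev := (mmap (@polyC K)).
Local Notation qhomog d g := (g \is d.-homog for (wdeg k)).
Implicit Types (f g q : {mpoly K[5]}) (A : 'I_5 -> {mpoly K[5]}).

Lemma qhomog_eq d e q : qhomog e q -> e = d -> qhomog d q.
Proof. by move=> h <-. Qed.

Lemma qhomogX i : qhomog (weight k i) ('X_i : {mpoly K[5]}).
Proof. by apply/qhomogP => m; rewrite msuppX inE => /eqP ->; exact: wdegU. Qed.

Lemma qhomogM d e p q : qhomog d p -> qhomog e q -> qhomog (d + e) (p * q).
Proof. exact: dhomogM. Qed.

Lemma qhomogN d q : qhomog d q -> qhomog d (- q).
Proof. by move=> hq; rewrite -scaleN1r; exact: dhomogZ. Qed.

Lemma qhomogXn i b : qhomog (weight k i * b) ('X_i ^+ b : {mpoly K[5]}).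
Proof. by apply: dhomogMn; exact: qhomogX. Qed.

(** The part of a minor of the pencil that contributes nothing at ['X = 0], divided
    by ['X]; see [pencil_minorE]. *)
Definition pencil_minor_rest A A' f f' (p : 'I_5 -> {poly K}) i s : {poly K} :=
  let b i := ev p (A i) - ev p (A' i) in
  let e i := ev p f^`M(i) - ev p f'^`M(i) in
  ev p (A' i) * e s + b i * ev p f'^`M(s) - ev p (A' s) * e i - b s * ev p f'^`M(i)
  + 'X * (b i * e s - b s * e i).

Lemma pencil_minorE A A' f f' p i s :
  pencil p (A i) (A' i) * pencil p f^`M(s) f'^`M(s)
    - pencil p (A s) (A' s) * pencil p f^`M(i) f'^`M(i) =
  ev p (A' i) * ev p f'^`M(s) - ev p (A' s) * ev p f'^`M(i)
    + 'X * pencil_minor_rest A A' f f' p i s.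
Proof. exact: minor_pencil0. Qed.

Lemma cong_pencil_minor_rest A A' f f' N (p p' : 'I_5 -> {poly K}) i s :
  (forall i, 'X^N %| p i - p' i) ->
  'X^N %| pencil_minor_rest A A' f f' p i s - pencil_minor_rest A A' f f' p' i s.
Proof.
move=> pp'; rewrite /pencil_minor_rest.
have cev q : 'X^N %| ev p q - ev p' q by exact: cong_mmap.
have cevB q q' : 'X^N %| (ev p q - ev p q') - (ev p' q - ev p' q').
  by apply: congD; [|apply: congN].
apply: congD; last by apply: congM (cong_refl _ _) (congD (congM _ _) (congN (congM _ _))).
exact: congD (congD (congD (congM (cev _) (cevB _ _)) (congM (cevB _ _) (cev _)))
  (congN (congM (cev _) (cevB _ _)))) (congN (congM (cevB _ _) (cev _))).
Qed.

Definition affine_chart (z : 'I_5 -> {poly K}) i := if i == ord0 then 1 else z i.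

Lemma cong_chart N z z' : (forall i, 'X^N %| z i - z' i) ->
  forall i, 'X^N %| affine_chart z i - affine_chart z' i.
Proof. by move=> h i; rewrite /affine_chart; case: ifP => // _; exact: cong_refl. Qed.

Lemma ev_chartX0 z c : ev (affine_chart z) ('X_ord0 ^+ c) = 1.
Proof. by rewrite rmorphXn /= mmapX mmap1U expr1n. Qed.

Section Degree3.
Variables (b e : nat).

(** In the chart [z_0 = 1], this is half the differential of
    [z_1 ^ 2 + z_2 ^ 2 + z_3 ^ 2], whose restriction to the hyperplane [z_4 = 0] has a
    nondegenerate zero at the origin. *)
Definition special_form3 (i : 'I_5) : {mpoly K[5]} := nth 0
  [:: - ('X_o1 ^+ 2 + 'X_o2 ^+ 2 + 'X_o3 ^+ 2) * 'X_ord0 ^+ e;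
      'X_o1 * 'X_ord0 ^+ e.+1; 'X_o2 * 'X_ord0 ^+ e.+1; 'X_o3 * 'X_ord0 ^+ e.+1; 0] i.

Definition special_eqn3 : {mpoly K[5]} := 'X_o4 * 'X_ord0 ^+ b.

Lemma special_eqn3_homog : qhomog (k + b) special_eqn3.
Proof.
by apply: qhomog_eq (qhomogM (qhomogX _) (qhomogXn _ _)) _; rewrite mul1n.
Qed.

Lemma special_form3_weighted : weighted_form k e.+3 special_form3.
Proof.
split; last first.
  rewrite sum5 /special_form3 /= mul0r mul0rn addr0 /weight /= !mulr1n !exprS; ring.
have sq i : weight k i = 1%N -> qhomog 2 ('X_i ^+ 2 : {mpoly K[5]}).
  by move=> wi; apply: qhomog_eq (qhomogXn _ _) _; rewrite wi.
have h2 : qhomog 2 (- ('X_o1 ^+ 2 + 'X_o2 ^+ 2 + 'X_o3 ^+ 2) : {mpoly K[5]}).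
  by apply: qhomogN; apply: rpredD; [apply: rpredD|]; exact: sq.
have hX i : qhomog (weight k i + e.+1 + weight k i)
    ('X_i * 'X_ord0 ^+ e.+1 * 'X_i : {mpoly K[5]}).
  apply: qhomogM (qhomogX _); apply: qhomog_eq (qhomogM (qhomogX _) (qhomogXn _ _)) _.
  by rewrite /weight /= mul1n.
apply: ord5_ind; rewrite /special_form3 /=; last by rewrite mul0r; exact: dhomog0.
- apply: qhomog_eq (qhomogM (qhomogM h2 (qhomogXn _ _)) (qhomogX _)) _.
  by rewrite /weight /= mul1n addn1.
all: by apply: qhomog_eq (hX _) _; rewrite /weight /= addn1 add1n.
Qed.

(** In the chart [z_0 = 1] the minors of the special pair with index 4 are [z_1],
    [z_2], [z_3] and its equation is [z_4].  Along the pencil the system thus reads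
    [z = 'X * r z].  The pivot is the derivative of the equation by [z_4], which
    is 1 for the special pair. *)
Lemma special3_path (A : 'I_5 -> {mpoly K[5]}) f : weighted_form k e.+3 A -> qhomog (k + b) f ->
  forall N, exists2 p, p ord0 = 1 & 'X^N %| pencil p f special_eqn3 /\ forall i j,
     'X^N %| pencil p (A i) (special_form3 i) * pencil p f^`M(j) special_eqn3^`M(j)
           - pencil p (A j) (special_form3 j) * pencil p f^`M(i) special_eqn3^`M(i).
Proof.
move=> hA hf N.
pose rho p i := pencil_minor_rest A special_form3 f special_eqn3 p i o4.
pose r z i := let p := affine_chart z in
  if i == o4 then - (ev p f - ev p special_eqn3) else - rho p i.
have [|z Hz] := @formal_fixpoint K 5 r _ N.
  move=> M z z' /cong_chart zz' i; rewrite /r; case: ifP => _; apply: congN.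
    by apply: congD; [|apply: congN]; exact: cong_mmap.
  exact: cong_pencil_minor_rest.
pose p := affine_chart z; have p0 : p ord0 = 1 by [].
have evX0 c : ev p ('X_ord0 ^+ c) = 1 by exact: ev_chartX0.
have df i : i != ord0 -> ev p special_eqn3^`M(i) = (o4 == i)%:R.
  rewrite eq_sym => i0; rewrite mderivMX_other // mderivXU evM evX0 mulr1.
  by rewrite rmorph_nat.
have f0 : 'X^N %| pencil p f special_eqn3.
  have := Hz o4; rewrite /r /= -/p; congr (is_true (_ %| _)).
  have -> : z o4 = ev p special_eqn3 by rewrite /special_eqn3 evM evX evX0 mulr1.
  by rewrite /pencil mulrN opprK.
exists p => //; split=> //.
apply: (pivot_pencil_minors hf special_eqn3_homog hA special_form3_weighted (s := o4)) => //.
  move=> i i0 i4; rewrite pencil_minorE !df // [o4 == i]eq_sym (negPf i4) eqxx mulr1 mulr0 subr0.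
  have := Hz i; rewrite /r (negPf i4) -/p mulrN opprK; congr (is_true (_ %| _)).
  congr (_ + _); have <- : p i = z i by rewrite /p /affine_chart (negPf i0).
  move: i i0 i4 {f0}; apply: ord5_ind => //= _ _; rewrite /special_form3 /= evM evX evX0 mulr1 //.
right; rewrite /pencil df //= hornerD hornerM hornerX mul0r addr0 hornerC oner_eq0 //.
Qed.

End Degree3.

Section Degree2.
Hypothesis two_neq0 : 2%:R != 0 :> K.
Variable b : nat.

(** The contact form of the projective space with coordinates [z_0, ..., z_3]. *)
Definition special_form2 (i : 'I_5) : {mpoly K[5]} := nth 0
  [:: - 'X_o1; 'X_ord0; - 'X_o3; 'X_o2; 0] i.

(** In the chart [z_0 = 1] this is [z_1 + z_4 ^ 2], a hypersurface tangent at the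
    origin to the kernel of the contact form [dz_1 + z_2 dz_3 - z_3 dz_2].  As the
    form does not involve [dz_4], the square is what makes the zero nondegenerate. *)
Definition special_eqn2 : {mpoly K[5]} :=
  'X_o1 * 'X_ord0 ^+ (b + k.*2).-1 + 'X_o4 ^+ 2 * 'X_ord0 ^+ b.

Lemma special_eqn2_homog : qhomog (b + k.*2) special_eqn2.
Proof.
apply: rpredD; first apply: qhomog_eq (qhomogM (qhomogX _) (qhomogXn _ _)) _.
  by rewrite /weight /= mul1n add1n prednK // addn_gt0 double_gt0 k_gt0 orbT.
apply: qhomog_eq (qhomogM (qhomogXn _ _) (qhomogXn _ _)) _.
by rewrite /weight /= mul1n muln2 addnC.
Qed.

Lemma special_form2_weighted : weighted_form k 2 special_form2.
Proof.
split; last first.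
  by rewrite sum5 /special_form2 /= mul0r mul0rn addr0 /weight /= !mulr1n; ring.
have hX i j : weight k i = 1%N -> weight k j = 1%N -> qhomog 2 ('X_i * 'X_j : {mpoly K[5]}).
  by move=> wi wj; apply: qhomog_eq (qhomogM (qhomogX _) (qhomogX _)) _; rewrite wi wj.
apply: ord5_ind; rewrite /special_form2 /= ?mulNr ?mul0r; last exact: dhomog0.
all: try apply: qhomogN; exact: hX.
Qed.

(** In the chart [z_0 = 1] the minors of the special pair with index 1 are [- z_3],
    [z_2] and [- 2 z_4], and its equation is [z_1 + z_4 ^ 2].  The system takes the
    form [z = 'X * r z] after [z_4 ^ 2] is rewritten with the value of [z_4] given
    by the last minor.  The pivot is the first coefficient of the form. *)
Lemma special2_path (A : 'I_5 -> {mpoly K[5]}) f : weighted_form k 2 A -> qhomog (b + k.*2) f ->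
  forall N, exists2 p, p ord0 = 1 & 'X^N %| pencil p f special_eqn2 /\ forall i j,
     'X^N %| pencil p (A i) (special_form2 i) * pencil p f^`M(j) special_eqn2^`M(j)
           - pencil p (A j) (special_form2 j) * pencil p f^`M(i) special_eqn2^`M(i).
Proof.
move=> hA hf N.
pose h : {poly K} := (2%:R^-1)%:P.
have h2 : 2%:R * h = 1 by rewrite /h -polyC_natr -polyCM divff.
pose rho p i := pencil_minor_rest A special_form2 f special_eqn2 p i o1.
pose r z (i : 'I_5) : {poly K} := let p := affine_chart z in nth 0
  [:: 0; - ('X * (h * rho p o4) ^+ 2 + (ev p f - ev p special_eqn2));
     - rho p o3; rho p o2; h * rho p o4] i.
have [|z Hz] := @formal_fixpoint K 5 r _ N.
  move=> M z z' /cong_chart zz'.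
  have crho i : 'X^M %| rho (affine_chart z) i - rho (affine_chart z') i.
    exact: cong_pencil_minor_rest.
  have crho4 : 'X^M %| h * rho (affine_chart z) o4 - h * rho (affine_chart z') o4.
    exact: congM (cong_refl _ _) (crho _).
  have cev q : 'X^M %| ev (affine_chart z) q - ev (affine_chart z') q by exact: cong_mmap.
  apply: ord5_ind; rewrite /r /=; [exact: cong_refl| |exact: congN|exact: crho|exact: crho4].
  rewrite !expr2; apply: congN; apply: congD.
    exact: congM (cong_refl _ _) (congM crho4 crho4).
  exact: congD (cev _) (congN (cev _)).
pose p := affine_chart z; have p0 : p ord0 = 1 by [].
have evX0 c : ev p ('X_ord0 ^+ c) = 1 by exact: ev_chartX0.
have df i : i != ord0 -> ev p special_eqn2^`M(i) = (o1 == i)%:R + 2%:R * p o4 * (o4 == i)%:R.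
  rewrite eq_sym => i0; rewrite mderivD !mderivMX_other // expr2 mderivM !mderivXU.
  rewrite !(evD, evM) !evX0 !evX !rmorph_nat !mulr1; ring.
have f0 : 'X^N %| pencil p f special_eqn2.
  have H1 := Hz o1; have H4 := Hz o4; rewrite /r /= -/p in H1 H4.
  have -> : pencil p f special_eqn2 =
    (z o1 - 'X * - ('X * (h * rho p o4) ^+ 2 + (ev p f - ev p special_eqn2)))
    + (z o4 + 'X * (h * rho p o4)) * (z o4 - 'X * (h * rho p o4)).
    have e2 : ev p special_eqn2 = z o1 + z o4 * z o4.
      by rewrite /special_eqn2 expr2 !(evD, evM) !evX0 !evX !mulr1.
    by rewrite /pencil {1}e2; ring.
  by apply: dvdp_add => //; exact: dvdp_mull.
exists p => //; split=> //.
have sf1 : ev p (special_form2 o1) = 1 by rewrite /special_form2 /= evX.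
have d1 : ev p special_eqn2^`M(o1) = 1 by rewrite df //= mulr0 addr0.
apply: (pivot_pencil_minors hf special_eqn2_homog hA special_form2_weighted (s := o1)) => //.
  apply: ord5_ind => // _ _; rewrite pencil_minorE sf1 d1 df //= -/(rho p _);
    rewrite mulr1 mul1r ?mulr0 ?mulr1 ?add0r ?addr0 ?subr0.
  - have := Hz o3; rewrite /r /= -/p => H3.
    by rewrite /special_form2 /= mmapN evX -dvdpNr opprD opprK.
  - have := Hz o2; rewrite /r /= -/p mulrN opprK.
    by rewrite /special_form2 /= evX.
  have := Hz o4; rewrite /r /= -/p => H4.
  have -> : ev p (special_form2 o4) - 2%:R * p o4 + 'X * rho p o4 =
     - 2%:R * (z o4 - 'X * (h * rho p o4)).
    have -> : 'X * rho p o4 = 2%:R * ('X * (h * rho p o4)).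
      by rewrite mulrCA [2%:R * (h * _)]mulrA h2 mul1r.
    by rewrite /special_form2 /= mmap0 -[z o4]/(p o4); ring.
  exact: dvdp_mull.
left; rewrite /pencil sf1 hornerD hornerM hornerX mul0r addr0 hornerC oner_eq0 //.
Qed.

End Degree2.
End SpecialPairs.

(** * Leading coefficients at the vertex *)

Lemma mpoly_gen_ind (K : nzRingType) n (P : {mpoly K[n]} -> Prop) :
  (forall c, P c%:MP) -> (forall i, P 'X_i) ->
  (forall p q, P p -> P q -> P (p + q)) -> (forall p q, P p -> P q -> P (p * q)) ->
  forall p, P p.
Proof.
move=> PC PX PD PM p; rewrite (mpolyE p).
elim/big_ind: _ => // [|m _]; first by rewrite -mpolyC0.
rewrite -mul_mpolyC mpolyXE_id; apply: (PM) => //.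
elim/big_ind: _ => // [|i _]; first by rewrite -mpolyC1.
by elim: (m i) => [|e IHe]; [rewrite expr0 -mpolyC1|rewrite exprS; apply: PM].
Qed.

Lemma deriv_mmap (K : comNzRingType) n (z : 'I_n -> {poly K}) (g : {mpoly K[n]}) :
  (mmap (@polyC K) z g)^`() = \sum_i mmap (@polyC K) z g^`M(i) * (z i)^`().
Proof.
elim/mpoly_gen_ind: g => [c|i|p q IHp IHq|p q IHp IHq].
- by rewrite mmapC derivC big1 // => i _; rewrite mderivC mmap0 mul0r.
- rewrite mmapX mmap1U (bigD1 i) //= mderivXU eqxx rmorph1 mul1r big1 ?addr0 // => j.
  by rewrite eq_sym mderivXU => /negPf ->; rewrite rmorph0 mul0r.
- rewrite mmapD derivD IHp IHq -big_split; apply: eq_bigr => i _.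
  by rewrite mderivD mmapD mulrDl.
- rewrite rmorphM /= derivM IHp IHq mulr_suml mulr_sumr -big_split; apply: eq_bigr => i _.
  by rewrite mderivM mmapD !rmorphM /=; ring.
Qed.

Lemma dvdp_Xn_coef (K : fieldType) n (p : {poly K}) :
  (forall i, (i < n)%N -> p`_i = 0) -> 'X^n %| p.
Proof.
move=> p0; rewrite -(poly_take_drop n p) (_ : take_poly n p = 0) ?add0r ?dvdp_mull //.
by apply/polyP => i; rewrite coef_take_poly coef0; case: ifP => // /p0.
Qed.

Section Jets.
Variables (K : fieldType) (k : nat).
Hypothesis k_gt1 : (1 < k)%N.
Local Notation qhomog d g := (g \is d.-homog for (wdeg k)).
Implicit Types (g h : {mpoly K[5]}) (q : 'I_5 -> K).

Definition vertex : 'I_5 -> K := fun i => (i == o4)%:R.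

(** The restriction to the curve [s |-> (s q, 1)] through the vertex. *)
Definition jet q g : {poly K} :=
  mmap (@polyC K) (fun i => if i == o4 then 1 else q i *: 'X) g.

Lemma jetM q g h : jet q (g * h) = jet q g * jet q h.
Proof. exact: rmorphM. Qed.

Lemma jetD q g h : jet q (g + h) = jet q g + jet q h.
Proof. exact: rmorphD. Qed.

Lemma jetX q i : jet q 'X_i = if i == o4 then 1 else q i *: 'X.
Proof. by rewrite /jet mmapX mmap1U. Qed.

Lemma jet0 q g : (jet q g).[0] = g.@[vertex].
Proof.
apply: (mpoly_rmorph_ext (v := meval vertex) (u := horner_eval 0 \o
  mmap (@polyC K) (fun i => if i == o4 then 1 else q i *: 'X))) => [c|i] /=.
  by rewrite mmapC /horner_eval hornerC mevalC.
rewrite mmapX mmap1U /horner_eval mevalXU /vertex; case: eqP => _; first by rewrite hornerC.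
by rewrite hornerZ hornerX mulr0.
Qed.

Lemma jet_coef1 q g : (jet q g)`_1 = \sum_(i | i != o4) g^`M(i).@[vertex] * q i.
Proof.
have -> : (jet q g)`_1 = (jet q g)^`().[0] by rewrite horner_coef0 coef_deriv.
rewrite /jet deriv_mmap horner_sum [RHS]big_mkcond; apply: eq_bigr => i _.
rewrite hornerM -/(jet q _) jet0; case: eqP => _ /=.
  by rewrite derivC horner0 mulr0.
by rewrite derivZ derivX alg_polyC hornerC.
Qed.

(** The exponents of [s] are congruent to the weighted degree modulo [k]. *)
Lemma jet_coef_deg q e g s : qhomog e g -> (jet q g)`_s != 0 -> exists j, (s + k * j)%N = e.
Proof.
move=> /dhomogP hg; rewrite /jet /mmap coef_sum => nz.
have [m mg cm] : exists2 m, m \in msupp g &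
    ((g@_m)%:P * mmap1 (fun i => if i == o4 then 1 else q i *: 'X) m)`_s != 0.
  apply: NNPP => H; case/eqP: nz; rewrite big_seq big1 // => m mg; apply/eqP.
  by apply: contraT => cm; case: H; exists m.
exists (m o4); rewrite -(hg _ mg); move: cm; rewrite coefCM /mmap1.
rewrite (bigD1 o4) //= expr1n mul1r.
rewrite (eq_bigr (fun i : 'I_5 => (q i ^+ m i)%:P * 'X^(m i))); last first.
  by move=> i /negPf ->; rewrite -mul_polyC exprMn -rmorphXn.
rewrite big_split /= -rmorph_prod prodrXr coefCM coefXn /=.
case: (s =P _) => [-> _|_]; last by rewrite !mulr0 eqxx.
rewrite [RHS]/wdeg [RHS](bigD1 o4) //= [RHS]addnC; congr (_ + _)%N.
by apply: eq_bigr => i io; rewrite /weight (_ : i == ord_max = false) ?mul1n //; apply: negPf.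
Qed.

(** The function [u] vanishes to order [k] along the curve given by [q], with
    leading coefficient [xi].  The vertex is the quotient of the origin of
    an affine space by the k-th roots of unity, so the leading terms of lowest
    order of the functions that vanish there are forms of degree [k] in
    [z_0, ..., z_3]; here [xi] is the value at [q] of such a form. *)
Definition has_lead q (u : {fraction {mpoly K[5]}}) (xi : K) :=
  exists g h, [/\ h.@[vertex] != 0, u = tofrac g / tofrac h &
    'X^(k.+1) %| jet q g - (xi * h.@[vertex]) *: 'X^k].

Lemma dvdp_XkM c (p : {poly K}) : 'X^(k.+1) %| c *: ('X^k * p - p.[0] *: 'X^k).
Proof.
rewrite -mul_polyC -mul_polyC dvdp_mull // mulrC -mulrBl exprS dvdp_mul //.
by rewrite -['X]subr0 -polyC0 dvdp_XsubCl rootE !hornerE subrr.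
Qed.

Lemma jet_coef0 q g : (jet q g)`_0 = g.@[vertex].
Proof. by rewrite -horner_coef0 jet0. Qed.

Lemma vertex_unit_neq0 h : h.@[vertex] != 0 -> tofrac h != 0.
Proof. by move=> h0; rewrite tofrac_eq0; apply: contraNneq h0 => ->; rewrite meval0. Qed.

(** The second factor vanishes to order [k], so only the value of the first one at
    the vertex matters; it is the same for all [q]. *)
Lemma has_leadM q g h x xi : h.@[vertex] != 0 -> has_lead q x xi ->
  has_lead q (tofrac g / tofrac h * x) (g.@[vertex] / h.@[vertex] * xi).
Proof.
move=> h0 [gx [hx [hx0 -> dx]]]; exists (g * gx), (h * hx); split.
- by rewrite mevalM mulf_neq0.
- by rewrite mulf_div !tofracM.
rewrite jetM mevalM (_ : _ / _ * xi * _ = xi * hx.@[vertex] * g.@[vertex]); last first.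
  by rewrite mulrACA divfK // mulrC.
have -> : jet q g * jet q gx - (xi * hx.@[vertex] * g.@[vertex]) *: 'X^k =
    jet q g * (jet q gx - (xi * hx.@[vertex]) *: 'X^k) +
    (xi * hx.@[vertex]) *: ('X^k * jet q g - (jet q g).[0] *: 'X^k).
  by rewrite jet0 -!mul_polyC !polyCM; ring.
by apply: dvdp_add; [exact: dvdp_mull|exact: dvdp_XkM].
Qed.

Lemma has_leadD q x y xi et :
  has_lead q x xi -> has_lead q y et -> has_lead q (x + y) (xi + et).
Proof.
move=> [g [h [h0 -> dg]]] [g' [h' [h0' -> dg']]]; exists (g * h' + g' * h), (h * h'); split.
- by rewrite mevalM mulf_neq0.
- by rewrite addf_div ?vertex_unit_neq0 // tofracD !tofracM.
have -> : jet q (g * h' + g' * h) - ((xi + et) * (h * h').@[vertex]) *: 'X^k =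
    jet q h' * (jet q g - (xi * h.@[vertex]) *: 'X^k)
    + jet q h * (jet q g' - (et * h'.@[vertex]) *: 'X^k)
    + (xi * h.@[vertex]) *: ('X^k * jet q h' - (jet q h').[0] *: 'X^k)
    + (et * h'.@[vertex]) *: ('X^k * jet q h - (jet q h).[0] *: 'X^k).
  by rewrite jetD !jetM !jet0 mevalM -!mul_polyC !(polyCM, polyCD); ring.
by do !apply: dvdp_add; rewrite ?dvdp_XkM ?dvdp_mull.
Qed.

Lemma has_lead0 q : has_lead q 0 0.
Proof.
exists 0, 1; rewrite meval1 oner_neq0 tofrac0 mul0r; split=> //.
by rewrite mul0r scale0r subr0 (_ : jet q 0 = 0) ?dvdp0 //; exact: rmorph0.
Qed.

Lemma has_lead_uniq q x xi et : has_lead q x xi -> has_lead q x et -> xi = et.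
Proof.
move=> [g [h [h0 -> dg]]] [g' [h' [h0' E dg']]].
move/eqP: E; rewrite eqr_div ?vertex_unit_neq0 // -!tofracM tofrac_eq => /eqP E.
have : 'X^(k.+1) %| ((et - xi) * (h.@[vertex] * h'.@[vertex])) *: ('X^k : {poly K}).
  have -> : ((et - xi) * (h.@[vertex] * h'.@[vertex])) *: 'X^k =
     (jet q (g' * h) - jet q (g * h'))
     + jet q h' * (jet q g - (xi * h.@[vertex]) *: 'X^k)
    - jet q h * (jet q g' - (et * h'.@[vertex]) *: 'X^k)
    + (xi * h.@[vertex]) *: ('X^k * jet q h' - (jet q h').[0] *: 'X^k)
    - (et * h'.@[vertex]) *: ('X^k * jet q h - (jet q h).[0] *: 'X^k).
    by rewrite !jetM !jet0 -!mul_polyC !(polyCM, polyCB); ring.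
  rewrite E subrr add0r; do !apply: dvdp_add; rewrite ?dvdpNr ?dvdp_XkM ?dvdp_mull //.
have [->//|ne] := eqVneq xi et.
rewrite dvdpZr; last by rewrite !mulf_neq0 // subr_eq0 eq_sym.
move/dvdp_leq; rewrite -size_poly_eq0 !size_polyXn => /(_ isT).
by rewrite ltnn.
Qed.

Lemma has_lead_vanishing q f g h : h.@[vertex] != 0 -> 'X^(k.+1) %| jet q f ->
  has_lead q (tofrac (f * g) / tofrac h) 0.
Proof.
move=> h0 df; exists (f * g), h; split=> //.
by rewrite mul0r scale0r subr0 jetM dvdp_mulr.
Qed.

(** As [h] does not vanish at the vertex, [e] is a multiple of [k], and so are the
    exponents in the jet of [g], which has no constant term. *)
Lemma has_lead_maximal q e g h : qhomog e g -> qhomog e h -> h.@[vertex] != 0 ->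
  g.@[vertex] = 0 -> has_lead q (tofrac g / tofrac h) ((jet q g)`_k / h.@[vertex]).
Proof.
move=> hg hh h0 g0; exists g, h; split=> //.
rewrite divfK //; apply: dvdp_Xn_coef => i; rewrite ltnS => ik.
rewrite coefB coefZ coefXn; case: (i =P k) => [->|/eqP nik]; first by rewrite mulr1 subrr.
rewrite mulr0 subr0; apply/eqP; apply: contraT => gi.
have [j jE] := jet_coef_deg hg gi.
have [|j' jE'] := jet_coef_deg (q := q) (s := 0) hh; first by rewrite jet_coef0.
have i0 : i = 0%N.
  have : (i + k * j = k * j' + 0)%N by rewrite jE -jE' addn0.
  move=> /(congr1 (modn^~ k)); rewrite addnC [(k * j)%N]mulnC [(k * j')%N]mulnC !modnMDl.
  by rewrite mod0n modn_small // ltn_neqAle nik.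
by move: gi; rewrite i0 jet_coef0 g0 eqxx.
Qed.

(** The exponents in the jet are congruent to 1 modulo [k], and the linear term
    vanishes when [q] is tangent to the cone. *)
Lemma jet_vanishing q j f : qhomog (k * j).+1 f -> f.@[vertex] = 0 ->
  \sum_(i | i != o4) f^`M(i).@[vertex] * q i = 0 -> 'X^(k.+1) %| jet q f.
Proof.
move=> hf f0 f1; apply: dvdp_Xn_coef => i; rewrite ltnS => ik.
apply/eqP; apply: contraT => fi; have [j' jE] := jet_coef_deg hf fi.
have E : (i = 1 %[mod k])%N.
  have := congr1 (modn^~ k) jE; rewrite addnC [(k * j')%N]mulnC -addn1 [(k * j)%N]mulnC.
  by rewrite !modnMDl.
move: fi; case: i ik jE E => [|[|i]] ik jE E; first by rewrite jet_coef0 f0 eqxx.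
  by rewrite jet_coef1 f1 eqxx.
move: ik; rewrite leq_eqVlt => /orP[/eqP ik|ik]; move: E.
  by rewrite ik modnn modn_small.
by rewrite !modn_small.
Qed.

End Jets.

(** * The vertex is not a smooth point *)

Lemma complementary_indices (i : 'I_5) : i != o4 -> exists u v w : 'I_5,
  [/\ [&& u != o4, v != o4 & w != o4], [&& u != i, v != i & w != i]
    & [&& u != v, u != w & v != w]].
Proof.
move: i; apply: ord5_ind => // _.
- by exists o1, o2, o3.
- by exists ord0, o2, o3.
- by exists ord0, o1, o3.
- by exists ord0, o1, o2.
Qed.

Section ApexSingular.
Variables (K : fieldType) (k : nat).
Hypothesis k_gt1 : (1 < k)%N.
Local Notation qhomog d g := (g \is d.-homog for (wdeg k)).

Variables (u v w : 'I_5).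
Hypothesis uvw_o4 : [&& u != o4, v != o4 & w != o4].

(** At the points (1,0,0), (0,1,0), (0,0,1) and (1,1,0) of the coordinates
    [u, v, w], these forms take the values of the identity matrix; for this the
    degree [k] has to be at least 2. *)
Definition test_forms (r : 'I_4) : {mpoly K[5]} := nth 0
  [:: 'X_u ^+ k - 'X_u * 'X_v ^+ k.-1; 'X_v ^+ k - 'X_u * 'X_v ^+ k.-1;
      'X_w ^+ k; 'X_u * 'X_v ^+ k.-1] r.

Definition test_values (x y z : K) (r : 'I_4) : K := nth 0
  [:: x ^+ k - x * y ^+ k.-1; y ^+ k - x * y ^+ k.-1; z ^+ k; x * y ^+ k.-1] r.

Lemma ord4_ind (P : 'I_4 -> Prop) : P ord0 -> P (@Ordinal 4 1 isT) -> P (@Ordinal 4 2 isT) ->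
  P (@Ordinal 4 3 isT) -> forall i, P i.
Proof.
move=> P0 P1 P2 P3 [m mP]; move: m mP => [|[|[|[|//]]]] mP.
- by rewrite (_ : Ordinal mP = ord0) //; exact: val_inj.
- by rewrite (_ : Ordinal mP = @Ordinal 4 1 isT) //; exact: val_inj.
- by rewrite (_ : Ordinal mP = @Ordinal 4 2 isT) //; exact: val_inj.
- by rewrite (_ : Ordinal mP = @Ordinal 4 3 isT) //; exact: val_inj.
Qed.

Lemma k_pred : k = k.-1.+1.
Proof. by rewrite prednK // ltnW. Qed.

Lemma weight1 i : i != o4 -> weight k i = 1%N.
Proof. by move=> /negPf io; rewrite /weight (_ : i == ord_max = false). Qed.

Lemma test_forms_homog r : qhomog k (test_forms r).
Proof.
case/and3P: uvw_o4 => uo vo wo.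
have hX i : i != o4 -> qhomog k ('X_i ^+ k : {mpoly K[5]}).
  move=> io; have := dhomogMn k (qhomogX K k i).
  by rewrite (weight1 io) mul1n.
have huv : qhomog k ('X_u * 'X_v ^+ k.-1 : {mpoly K[5]}).
  have := dhomogM (qhomogX K k u) (dhomogMn k.-1 (qhomogX K k v)).
  by rewrite (weight1 uo) (weight1 vo) mul1n add1n -k_pred.
move: r; apply: ord4_ind; rewrite /test_forms //=; try exact: hX.
all: by apply: rpredB => //; exact: hX.
Qed.

Lemma jet_test_forms q r :
  jet q (test_forms r) = test_values (q u) (q v) (q w) r *: 'X^k.
Proof.
case/and3P: uvw_o4 => /negPf uo /negPf vo /negPf wo.
have jXn i e : i == o4 = false -> jet q ('X_i ^+ e) = (q i ^+ e) *: 'X^e.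
  move=> io; have -> : jet q ('X_i ^+ e) = jet q 'X_i ^+ e by exact: rmorphXn.
  by rewrite jetX io exprZn.
have jB g h : jet q (g - h) = jet q g - jet q h by exact: rmorphB.
have juv : jet q ('X_u * 'X_v ^+ k.-1) = (q u * q v ^+ k.-1) *: 'X^k.
  by rewrite jetM jetX uo (jXn _ _ vo) -scalerAl -scalerAr scalerA -exprS -k_pred.
move: r; apply: ord4_ind; rewrite /test_forms /test_values /= ?jB ?juv ?jXn // scalerBl //.
Qed.

(** Leading coefficients in directions tangent to the cone do not see the ideal of
    V.  In four such directions the test forms have leading coefficients that form
    an invertible matrix of size 4, which cannot factor through the three
    generators of the maximal ideal. *)
Lemma vertex_not_regular f j i : qhomog (k * j).+1 f -> f.@[vertex K] = 0 ->
  i != o4 -> f^`M(i).@[vertex K] != 0 -> u != i -> v != i -> w != i ->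
  [&& u != v, u != w & v != w] ->
  forall x : 'I_3 -> {fraction {mpoly K[5]}},
  (forall l, exists e g h, [/\ qhomog e g, qhomog e h, h.@[vertex K] != 0,
     g.@[vertex K] = 0 & x l = tofrac g / tofrac h]) ->
  ~ (forall y, (exists e g h, [/\ qhomog e g, qhomog e h, h.@[vertex K] != 0,
       g.@[vertex K] = 0 & y = tofrac g / tofrac h]) ->
     exists2 c : 'I_3 -> {fraction {mpoly K[5]}},
       forall l, exists e g h, [/\ qhomog e g, qhomog e h, h.@[vertex K] != 0
          & c l = tofrac g / tofrac h]
     & exists e g h, [/\ qhomog e (f * g), qhomog e h, h.@[vertex K] != 0
         & y - \sum_(l < 3) c l * x l = tofrac (f * g) / tofrac h]).
Proof.
move=> hf f0 io fi ui vi wi /and3P[uv uw vw] x xmax xgen.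
case/and3P: (uvw_o4) => uo vo wo.
pose t (s : 'I_4) (m : 'I_5) : K := nth 0
  [:: (m == u)%:R; (m == v)%:R; (m == w)%:R; (m == u)%:R + (m == v)%:R] s.
pose l (p : 'I_5 -> K) := \sum_(m | m != o4) f^`M(m).@[vertex K] * p m.
(* The points, corrected in the coordinate [i] so as to be tangent to the cone. *)
pose q s m := t s m - (m == i)%:R * (l (t s) / f^`M(i).@[vertex K]).
have lq s : l (q s) = 0.
  rewrite /l; under eq_bigr do rewrite mulrBr; rewrite sumrB.
  rewrite [X in _ - X](_ : _ = l (t s)) ?subrr //.
  rewrite (bigD1 i) //= eqxx mul1r mulrCA divff // mulr1 big1 ?addr0 //.
  by move=> m /andP[_ /negPf ->]; rewrite mul0r mulr0.
have qt s m : m != i -> q s m = t s m by move=> /negPf mi; rewrite /q mi mul0r subr0.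
have df s : 'X^(k.+1) %| jet (q s) f by exact: jet_vanishing hf f0 (lq s).
have [xi xiP] : exists xi : 'I_3 -> 'I_4 -> K, forall l s, has_lead k (q s) (x l) (xi l s).
  apply: (fin_all_exists (P := fun l xi => forall s, has_lead k (q s) (x l) (xi s))) => m.
  have [e [g [h [hg hh h0 g0 ->]]]] := xmax m.
  by exists (fun s => (jet (q s) g)`_k / h.@[vertex K]) => s; exact: has_lead_maximal hg hh h0 g0.
pose y r := tofrac (test_forms r) / tofrac ('X_o4 : {mpoly K[5]}).
have X4 : ('X_o4 : {mpoly K[5]}).@[vertex K] = 1 by rewrite mevalXU /vertex eqxx.
have yP r s : has_lead k (q s) (y r) (r == s)%:R.
  exists (test_forms r), 'X_o4; rewrite X4 oner_neq0 mulr1; split=> //.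
  rewrite jet_test_forms -scalerBl !qt // (_ : test_values _ _ _ r = (r == s)%:R).
    by rewrite subrr scale0r dvdp0.
  have [m km] : exists m, k = m.+2 by exists k.-2; rewrite k_pred; case: (k) k_gt1 => [|[|]].
  rewrite /t /test_values km /=.
  move/negPf: uv => uv; move/negPf: uw => uw; move/negPf: vw => vw.
  have [vu wu wv] : [/\ (v == u) = false, (w == u) = false & (w == v) = false].
    by rewrite eq_sym uv eq_sym uw eq_sym vw.
  move: s r; apply: ord4_ind => /=;
    rewrite !eqxx ?uv ?uw ?vw ?vu ?wu ?wv ?addr0 ?add0r ?expr1n ?expr0n /=;
    elim/ord4_ind; rewrite /= ?mulr1 ?mulr0 ?subr0 ?subrr //.
have e4 r : exists e g h, [/\ qhomog e g, qhomog e h, h.@[vertex K] != 0,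
       g.@[vertex K] = 0 & y r = tofrac g / tofrac h].
  exists k, (test_forms r), 'X_o4; split=> //.
  - exact: test_forms_homog.
  - exact: qhomog_eq (qhomogX _ _ _) _.
  - by rewrite X4 oner_neq0.
  rewrite -(jet0 (fun=> 0)) jet_test_forms hornerZ hornerXn expr0n.
  by rewrite (k_pred) mulr0.
have [ga gaP] : exists ga : 'I_4 -> 'I_3 -> K, forall r s, \sum_l ga r l * xi l s = (r == s)%:R.
  apply: (fin_all_exists (P := fun r ga => forall s, \sum_l ga l * xi l s = (r == s)%:R)) => r.
  have [c cP [e [g [h [hg hh h0 E]]]]] := xgen _ (e4 r).
  have [ga gaP] : exists ga : 'I_3 -> K, forall l s xi, has_lead k (q s) (x l) xi ->
      has_lead k (q s) (c l * x l) (ga l * xi).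
    apply: (fin_all_exists (P := fun l ga => forall s xi, has_lead k (q s) (x l) xi ->
      has_lead k (q s) (c l * x l) (ga * xi))) => m.
    have [e' [g' [h' [_ _ h0' ->]]]] := cP m.
    by exists (g'.@[vertex K] / h'.@[vertex K]) => s z; exact: has_leadM.
  exists ga => s; apply: has_lead_uniq (yP r s).
  have -> : y r = \sum_(l < 3) c l * x l + tofrac (f * g) / tofrac h by rewrite -E addrC subrK.
  rewrite -[X in has_lead _ _ _ X]addr0; apply: has_leadD; last exact: has_lead_vanishing.
  elim/big_rec2: _ => [|m z z' _ Hz]; first exact: has_lead0.
  by apply: has_leadD Hz; apply: gaP; exact: xiP.
have : \matrix_(r < 4, l < 3) ga r l *m \matrix_(l < 3, s < 4) xi l s = 1%:M.
  apply/matrixP => r s; rewrite !mxE -gaP; apply: eq_bigr => m _; by rewrite !mxE.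
by move/mulmx1_min.
Qed.

End ApexSingular.

(** * Regular distributions *)

Lemma wdeg_eq0 k m : (0 < k)%N -> wdeg k m = 0%N -> m = 0%MM.
Proof.
move=> k0 E; apply/eqP; rewrite -mdeg_eq0 -leqn0.
suff : (mdeg m <= wdeg k m)%N by rewrite E.
apply: (mdeg_le_measure (mf := wdeg k)) => j.
by move: (wdegU k j) => /= ->; rewrite /weight; case: ifP.
Qed.

(** In degree 1 the coefficients of the form are constants, present only in the
    directions of weight 1, and the contraction with the Euler field reads them off
    one by one. *)
Lemma weighted_form1_eq0 (K : fieldType) k (A : 'I_5 -> {mpoly K[5]}) :
  (0 < k)%N -> weighted_form k 1 A -> forall i, A i = 0.
Proof.
move=> k0 [hA eA].
have w0 i : (0 < weight k i)%N by rewrite /weight; case: ifP.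
have supp i m : m \in msupp (A i) -> m = 0%MM /\ weight k i = 1%N.
  move=> mA; have E := wdeg_shift (hA i) mA.
  have wi : weight k i = 1%N.
    by apply/eqP; rewrite eqn_leq w0 andbT -E leq_addl.
  by split=> //; apply: (wdeg_eq0 k0); move: E; rewrite wi addn1 => -[].
have cA i : A i = ((A i)@_0%MM)%:MP.
  apply/mpolyP => m; rewrite mcoeffC; case: eqP => [->|m0]; first by rewrite mulr1.
  by rewrite mulr0; apply/eqP; rewrite mcoeff_eq0; apply/negP => /supp[].
move=> i; have [//|Ai] := eqVneq (A i) 0.
have c0 : (A i)@_0%MM != 0 by apply: contraNneq Ai => E; rewrite cA E.
have wi : weight k i = 1%N by have [] := supp i 0%MM; rewrite ?mcoeff_msupp.
have := congr1 (mcoeff U_(i)%MM) eA; rewrite raddf_sum mcoeff0 (bigD1 i) //= big1.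
  rewrite addr0 wi mulr1n cA mcoeffCM mcoeffX eqxx mulr1 => E.
  by rewrite E eqxx in c0.
move=> j ji; rewrite mcoeffMn cA mcoeffCM mcoeffX.
by rewrite eq_mnm1 (negPf ji) mulr0 mul0rn.
Qed.

Lemma vertex_deriv_eq0 (K : fieldType) k e (f : {mpoly K[5]}) : k%:R != 0 :> K ->
  f \is e.-homog for (wdeg k) -> f.@[vertex K] = 0 -> f^`M(o4).@[vertex K] = 0.
Proof.
move=> k0 hf f0; have := congr1 (meval (vertex K)) (euler_identity hf).
rewrite mevalMn f0 mul0rn sum5 !mevalD !mevalMn !mevalM !mevalXU /vertex /=.
rewrite !mulr0 !mul0rn !add0r mulr1 -[weight k o4]/k -mulr_natr => /eqP.
by rewrite mulf_eq0 (negPf k0) orbF => /eqP.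
Qed.

Lemma vertex_deriv_degree (K : fieldType) k e (f : {mpoly K[5]}) i :
  f \is e.-homog for (wdeg k) -> i != o4 -> f^`M(i).@[vertex K] != 0 ->
  exists j, (k * j).+1 = e.
Proof.
move=> hf io fi; have [|j <-] := jet_coef_deg (q := fun m => (m == i)%:R) (s := 1) hf.
  rewrite jet_coef1 (bigD1 i) //= eqxx mulr1 big1 ?addr0 //.
  by move=> m /andP[_ /negPf ->]; rewrite mulr0.
by exists j.
Qed.

Section Hypersurfaces.
Variables (R : realType) (k : nat).
Hypothesis k_gt0 : (0 < k)%N.
Variable V : hypersurface R k.
Hypothesis smoothV : smooth_hypersurface V.
Local Notation f := (heqn V).

Lemma heqn_qhomog : f \is (hdeg V).-homog for (wdeg k).
Proof. exact: heqn_homog. Qed.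

(** If the cone is smooth along the line of the vertex, one of the first four
    derivatives is nonzero there, which forces the degree of V to be 1 modulo [k], and [vertex_not_regular]
    applies. *)
Lemma vertex_notin_smooth : (1 < k)%N -> f.@[vertex (complex R)] != 0.
Proof.
move=> k1; apply/eqP => f0; have [manV coneV] := smoothV.
have onV : on_hypersurface V (vertex (complex R)).
  by split=> //; exists o4; rewrite /vertex eqxx oner_neq0.
have [i fi] := coneV _ onV.
have io : i != o4.
  apply: contraNneq fi => ->; apply/eqP; apply: vertex_deriv_eq0 heqn_qhomog f0.
  by rewrite pnatr_eq0 -lt0n.
have [j aE] := vertex_deriv_degree heqn_qhomog io fi.
have hf : f \is (k * j).+1.-homog for (wdeg k) by apply: qhomog_eq heqn_qhomog _; rewrite -aE.
have [u [v [w [uvw /and3P[ui vi wi] uvw']]]] := complementary_indices io.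
have [x xmax xgen] := manV _ onV.
exact: (vertex_not_regular k1 uvw hf f0 io fi ui vi wi uvw' xmax xgen).
Qed.

Lemma hdeg_gt0 p : on_hypersurface V p -> (0 < hdeg V)%N.
Proof.
move=> onp; rewrite lt0n; apply/eqP => a0; have [_ coneV] := smoothV.
have [i fi] := coneV p onp; case/eqP: fi.
have -> : f = (f@_0%MM)%:MP.
  apply/mpolyP => m; rewrite mcoeffC; case: eqP => [->|m0]; first by rewrite mulr1.
  rewrite mulr0; apply/eqP; rewrite mcoeff_eq0; apply/negP => mf; apply: m0.
  by apply: (wdeg_eq0 k_gt0); rewrite (dhomog_mf heqn_qhomog mf) a0.
by rewrite mderivC meval0.
Qed.

Lemma hdeg_multiple p : on_hypersurface V p -> exists m, hdeg V = (k * m.+1)%N.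
Proof.
move=> onp; have a0 := hdeg_gt0 onp.
have [m E] : exists m, (k * m)%N = hdeg V.
  have [k1|k1] := ltnP 1 k; last first.
    exists (hdeg V); have : (k * hdeg V == 1 * hdeg V)%N; last by rewrite mul1n => /eqP.
    by rewrite eqn_mul2r [(k == 1)%N]eqn_leq k1 k_gt0 orbT.
  have [|j <-] := jet_coef_deg (q := fun=> 0) (s := 0) heqn_qhomog; last by exists j.
  by rewrite jet_coef0 vertex_notin_smooth.
case: m E => [|m] E; last by exists m.
by rewrite -E muln0 in a0.
Qed.

(** Where all minors vanish, the form is a multiple of df, because df is not zero
    on the cone; it then vanishes on the tangent space. *)
Lemma regular_no_zero (D : distribution V) : regular_distribution D ->
  forall x, (exists i, x i != 0) -> f.@[x] != 0 \/
    exists i j, (dform D i * f^`M(j) - dform D j * f^`M(i)).@[x] != 0.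
Proof.
move=> regD x x0; apply: NNPP => H; apply: (regD x).
have fx : f.@[x] = 0 by apply/eqP; apply: contraT => fx; case: H; left.
have onx : on_hypersurface V x by [].
have mx i j : (dform D i).@[x] * f^`M(j).@[x] = (dform D j).@[x] * f^`M(i).@[x].
  apply/eqP; rewrite -subr_eq0 -!mevalM -mevalB; apply: contraT => nz.
  by case: H; right; exists i, j.
split=> // v tv; have [i fi] := smoothV.2 x onx.
apply: (mulIf fi); rewrite mul0r /form_at mulr_suml.
rewrite (eq_bigr (fun j => (dform D i).@[x] * (f^`M(j).@[x] * v j))).
  by rewrite -mulr_sumr tv mulr0.
by move=> j _; rewrite mulrAC -(mx i j) mulrA.
Qed.

End Hypersurfaces.

Theorem theorem4p3 (R : realType) (k : nat) (hk : (0 < k)%N)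
    (V : hypersurface R k) (hV : smooth_hypersurface V)
    (D : distribution V) (hD : regular_distribution D) :
  hdeg V = k /\ ddeg D = 2%N.
Proof.
have [p onp np] := dform_neq0 D.
have nozero := regular_no_zero hV hD.
have hf := heqn_qhomog V.
have hA : weighted_form k (ddeg D) (dform D) := dform_twisted D.
have [m aE] := hdeg_multiple hk hV onp.
have := ddeg_gt0 D; case dE : (ddeg D) hA => [//|[|[|e]]] hA _.
- case: np => v _; rewrite /form_at big1 // => i _.
  by rewrite (weighted_form1_eq0 hk hA) meval0 mul0r.
- split=> //; case: m aE => [|m] aE; first by rewrite aE muln1.
  have aE' : hdeg V = (k * m + k.*2)%N by rewrite aE !mulnS -addnn addnA addnC.
  rewrite aE' in hf; have two0 : 2%:R != 0 :> complex R by rewrite pnatr_eq0.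
  case: (no_formal_deformation hk hf (special_eqn2_homog _ hk _) hA
    (special_form2_weighted _ _) nozero).
  exact: special2_path.
rewrite aE mulnS in hf.
case: (no_formal_deformation hk hf (special_eqn3_homog _ _ _) hA
  (special_form3_weighted _ _ _) nozero).
exact: special3_path hA hf.
Qed.
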